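(* Let $l$ be an odd prime. Let $d$ be a squarefree integer not equal to one such that $F=\mathbb{Q}(\sqrt{d})$ is an imaginary quadratic field with class number $h_F=l$. Let $L$ be the Hilbert class field of $F$ and let $\Delta_F$ be the discriminant of $F$. Let $p$ and $q$ be distinct odd positive primes such that $\left(\frac{q}{p}\right)\neq 1$ and $p\equiv q\equiv 3\pmod 4$. Then the quaternion algebra $H_L(p,q)$ is a division algebra if and only if $\left(\frac{\Delta_F}{p}\right)=1$ or $d\equiv 1\pmod 8$.
   Context: For a field $F$ of characteristic $\neq 2$ and $a,b\in F\setminus\{0\}$, $H_F(a,b)$ denotes the generalized quaternion algebra over $F$ with basis $1,i,j,k$ and relations $i^2=a$, $j^2=b$, $ij=-ji=k$. $\left(\frac{m}{\ell}\right)$ is the Legendre symbol for an odd prime $\ell$, equal to $0$ if $\ell\mid m$. The discriminant of $\mathbb{Q}(\sqrt d)$ is $d$ if $d\equiv 1\pmod 4$ and $4d$ otherwise. *)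

(* Defs.v *)
From HB Require Import structures.
From mathcomp Require Import all_boot all_order all_algebra all_fingroup.
From mathcomp Require Import all_solvable all_field.
From mathcomp Require Import ring.
From mathcomp Require Import boolp classical_sets functions cardinality.

Set Implicit Arguments.
Unset Strict Implicit.
Unset Printing Implicit Defensive.

Import Order.TTheory GRing.Theory Num.Theory.
Local Open Scope classical_set_scope.
Local Open Scope ring_scope.

(* Meaningful for F of characteristic other than 2 and nonzero a, b.
   Quat x0 x1 x2 x3 stands for x0 + x1 i + x2 j + x3 k. *)
Record quaternion (F : fieldType) (a b : F) : Type := Quat {
  quat_re : F; quat_i : F; quat_j : F; quat_k : F
}.

Section QuaternionAlgebra.
Context (F : fieldType) (a b : F).
Local Notation H := (quaternion a b).
Local Notation Q := (@Quat F a b).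
Implicit Types x y z : H.

Definition quat_tuple x := (quat_re x, quat_i x, quat_j x, quat_k x).
Definition tuple_quat (u : F * F * F * F) : H :=
  let: (x0, x1, x2, x3) := u in Q x0 x1 x2 x3.

Lemma quat_tupleK : cancel quat_tuple tuple_quat. Proof. by case. Qed.

HB.instance Definition _ := Equality.copy H (can_type quat_tupleK).
HB.instance Definition _ := Choice.copy H (can_type quat_tupleK).

Definition quat_zero : H := Q 0 0 0 0.
Definition quat_one : H := Q 1 0 0 0.
Definition quat_opp x : H :=
  Q (- quat_re x) (- quat_i x) (- quat_j x) (- quat_k x).
Definition quat_add x y : H :=
  Q (quat_re x + quat_re y) (quat_i x + quat_i y)
    (quat_j x + quat_j y) (quat_k x + quat_k y).
Definition quat_scale (c : F) x : H :=
  Q (c * quat_re x) (c * quat_i x) (c * quat_j x) (c * quat_k x).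

Definition quat_mul x y : H :=
  let: Quat x0 x1 x2 x3 := x in
  let: Quat y0 y1 y2 y3 := y in
  Q (x0 * y0 + a * x1 * y1 + b * x2 * y2 - a * b * x3 * y3)
    (x0 * y1 + x1 * y0 - b * x2 * y3 + b * x3 * y2)
    (x0 * y2 + x2 * y0 + a * x1 * y3 - a * x3 * y1)
    (x0 * y3 + x3 * y0 + x1 * y2 - x2 * y1).

Fact quat_addA : associative quat_add.
Proof. by move=> [????] [????] [????]; congr Quat; rewrite /= addrA. Qed.
Fact quat_addC : commutative quat_add.
Proof. by move=> [????] [????]; congr Quat; rewrite /= addrC. Qed.
Fact quat_add0 : left_id quat_zero quat_add.
Proof. by move=> [????]; congr Quat; rewrite /= add0r. Qed.
Fact quat_addN : left_inverse quat_zero quat_opp quat_add.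
Proof. by move=> [????]; congr Quat; rewrite /= addNr. Qed.

HB.instance Definition _ :=
  GRing.isZmodule.Build H quat_addA quat_addC quat_add0 quat_addN.

Fact quat_mulA : associative quat_mul.
Proof. by move=> [????] [????] [????]; congr Quat; ring. Qed.
Fact quat_mul1l : left_id quat_one quat_mul.
Proof. by move=> [????]; congr Quat; ring. Qed.
Fact quat_mul1r : right_id quat_one quat_mul.
Proof. by move=> [????]; congr Quat; ring. Qed.
Fact quat_mulDl : left_distributive quat_mul +%R.
Proof. by move=> [????] [????] [????]; congr Quat; rewrite /=; ring. Qed.
Fact quat_mulDr : right_distributive quat_mul +%R.
Proof. by move=> [????] [????] [????]; congr Quat; rewrite /=; ring. Qed.
Fact quat_one_neq0 : quat_one != 0.
Proof. by apply/eqP => -[] /eqP; rewrite oner_eq0. Qed.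

HB.instance Definition _ := GRing.Zmodule_isNzRing.Build H
  quat_mulA quat_mul1l quat_mul1r quat_mulDl quat_mulDr quat_one_neq0.

Fact quat_scaleA c e x : quat_scale c (quat_scale e x) = quat_scale (c * e) x.
Proof. by congr Quat; rewrite /= mulrA. Qed.
Fact quat_scale1 : left_id 1 quat_scale.
Proof. by move=> [????]; congr Quat; rewrite /= mul1r. Qed.
Fact quat_scaleDr : right_distributive quat_scale +%R.
Proof. by move=> c [????] [????]; congr Quat; rewrite /= mulrDr. Qed.
Fact quat_scaleDl x : {morph quat_scale^~ x : c e / c + e}.
Proof. by move=> c e; congr Quat; rewrite /= mulrDl. Qed.

HB.instance Definition _ := GRing.Zmodule_isLmodule.Build F H
  quat_scaleA quat_scale1 quat_scaleDr quat_scaleDl.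

Fact quat_scaleAl (c : F) x y : c *: (x * y) = (c *: x) * y.
Proof. by case: x y => [????] [????]; congr Quat; rewrite /=; ring. Qed.

HB.instance Definition _ := GRing.Lmodule_isLalgebra.Build F H quat_scaleAl.

Fact quat_scaleAr (c : F) x y : c *: (x * y) = x * (c *: y).
Proof. by case: x y => [????] [????]; congr Quat; rewrite /=; ring. Qed.

HB.instance Definition _ := GRing.Lalgebra_isAlgebra.Build F H quat_scaleAr.

Definition qi : H := Q 0 1 0 0.
Definition qj : H := Q 0 0 1 0.
Definition qk : H := Q 0 0 0 1.

Lemma qi_sqr : qi * qi = a%:A.
Proof. by congr Quat; rewrite /=; ring. Qed.
Lemma qj_sqr : qj * qj = b%:A.
Proof. by congr Quat; rewrite /=; ring. Qed.
Lemma qi_qj : qi * qj = qk.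
Proof. by congr Quat; rewrite /=; ring. Qed.
Lemma qj_qi : qj * qi = - qk.
Proof. by congr Quat; rewrite /=; ring. Qed.
Lemma quatE (x0 x1 x2 x3 : F) :
  Q x0 x1 x2 x3 = x0%:A + x1 *: qi + x2 *: qj + x3 *: qk.
Proof. by congr Quat; rewrite /=; ring. Qed.

End QuaternionAlgebra.

Definition division_algebra (F : fieldType) (A : algType F) : Prop :=
  forall x : A, x != 0 -> exists y : A, x * y = 1 /\ y * x = 1.

Definition legendre (m : int) (l : nat) : int :=
  if (l%:Z %| m)%Z then 0
  else if [exists x : 'I_l, (m == x%:Z ^+ 2 %[mod l%:Z])%Z] then 1 else -1.

Definition squarefree (d : int) : Prop :=
  forall m : int, (m ^+ 2 %| d)%Z -> m \is a GRing.unit.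

Definition generated_by_sqrt (F : fieldExtType rat) (d : int) : Prop :=
  exists s : F, s ^+ 2 = d%:~R /\ <<1; s>>%VS = fullv.

(* The discriminant of Q(sqrt d), for squarefree d. *)
Definition quadratic_disc (d : int) : int :=
  if (d == 1 %[mod 4])%Z then d else 4 * d.

Definition integers (K : fieldType) : set K :=
  [set x | integralOver (intr : int -> K) x].
Arguments integers : clear implicits.

Section Ideals.
Context (K : fieldType).
Implicit Types I J P : set K.

Definition is_ideal I : Prop :=
  [/\ I `<=` integers K, I 0,
      forall x y, I x -> I y -> I (x + y)
    & forall c x, integers K c -> I x -> I (c * x)].

Definition nonzero_ideal I : Prop := is_ideal I /\ exists2 x, I x & x != 0.

Definition prime_ideal P : Prop :=
  [/\ is_ideal P, ~ P 1
    & forall x y, integers K x -> integers K y -> P (x * y) -> P x \/ P y].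

Definition nonzero_prime P : Prop := nonzero_ideal P /\ prime_ideal P.

Definition ideal_mul I J : set K :=
  [set z | exists (n : nat) (x y : 'I_n -> K),
     [/\ forall i, I (x i), forall i, J (y i) & z = \sum_i x i * y i]].

Definition ideal_exp I (n : nat) : set K := iter n (ideal_mul I) (integers K).

Definition ideal_equiv I J : Prop :=
  exists x y : K, [/\ integers K x, integers K y, x != 0, y != 0
    & [set x * z | z in I] = [set y * z | z in J]].

Definition ideal_class I : set (set K) :=
  [set J | nonzero_ideal J /\ ideal_equiv I J].

Definition ideal_classes : set (set (set K)) :=
  [set ideal_class I | I in nonzero_ideal].

End Ideals.

Definition has_class_number (K : fieldType) (h : nat) : Prop :=
  (@ideal_classes K #= `I_h)%card.

Section Extensions.
Context (F : fieldExtType rat).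

Definition ideal_extend (L : fieldExtType F) (P : set F) : set L :=
  ideal_mul [set x%:A | x in P] (integers L).

(* e is the exponent of Q in the factorization of P O_L. *)
Definition ramification_index (L : fieldExtType F)
    (P : set F) (Q : set L) (e : nat) : Prop :=
  @ideal_extend L P `<=` ideal_exp Q e /\
  ~ (@ideal_extend L P `<=` ideal_exp Q e.+1).

(* Residue fields are finite, so their extensions are always separable. *)
Definition unramified_finite (L : fieldExtType F) : Prop :=
  forall (P : set F) (Q : set L), nonzero_prime P -> nonzero_prime Q ->
    @ideal_extend L P `<=` Q -> ramification_index P Q 1.

(* Complex embeddings are embeddings into algC, since L is algebraic over the
   rationals; no real place of F becomes complex in L. *)
Definition unramified_infinite (L : fieldExtType F) : Prop :=
  forall sigma : {rmorphism L -> algC},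
    (forall x : F, sigma x%:A \is Num.real) ->
    forall y : L, sigma y \is Num.real.

Definition unramified_abelian (L : splittingFieldType F) : Prop :=
  [/\ galois 1%VS {:L}, abelian 'Gal({:L} / 1),
      unramified_finite L & unramified_infinite L].

(* No ambient algebraic closure is fixed, so maximality is stated up to
   F-embedding. *)
Definition is_hilbert_class_field (L : splittingFieldType F) : Prop :=
  unramified_abelian L /\
  forall K : splittingFieldType F, unramified_abelian K -> inhabited 'AHom(K, L).

End Extensions.

(* Main.v *)
(* Since [(q/p) = -1] and [p = q = 3 (mod 4)], the rational algebra [H(p, q)] is
   [H(p, -1)], ramified exactly at [2] and [p].  The extension [L/F] has odd
   degree, so [H_L(p, q)] is split if and only if [q] is a norm from
   [F(sqrt p)]; this is impossible when [p] or [2] splits in [F], because [F] then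
   embeds in the field of [p]-adic or [2]-adic numbers.  If neither prime splits,
   the norm is written down explicitly: genus theory and the oddness of the class
   number force [d = -1], [d = -2] or [d = -r] with [r = 3 (mod 4)] prime, and
   then Legendre's theorem on ternary forms applies, with local conditions given
   by quadratic reciprocity.

   For the degree: if it were even, [L] would contain [sqrt a] for some
   non-square [a] in [F].  The conjugate field of [L] over [Q] is again unramified
   and abelian over [F], so by maximality [L] also contains the square root of the
   conjugate of [a], hence [sqrt m] for a rational integer [m] that is not a
   square in [F], and [F(sqrt m)/F] ramifies. *)

Require Import Defs.
From HB Require Import structures.
From mathcomp Require Import all_boot all_order all_algebra all_fingroup.
From mathcomp Require Import all_solvable all_field.
From mathcomp Require Import boolp classical_sets functions cardinality.
From mathcomp Require Import zify ring lra.

Set Implicit Arguments.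
Unset Strict Implicit.
Unset Printing Implicit Defensive.

Import Order.TTheory GRing.Theory Num.Theory.
Local Open Scope ring_scope.

(** * Ternary quadratic forms over the integers *)

(** By Legendre's theorem and reciprocity [-q] is a norm from Q(sqrt p), so [q] becomes a norm over
    [F] as soon as [-1] does; the explicit half of the proof is therefore a question about [p] and
    [d] alone. The odd degree serves only the other half. There [d = -1] stays outside the degree
    argument, because for that value neither alternative of the condition on [p] and [d] can hold.
    No completion is built: an embedding of [F] in the [l]-adic numbers is replaced by square roots
    of [d] modulo every power of [l], and anisotropy by a divisibility statement at each finite
    level. Ideals are never factored either. Genus theory uses only an ideal [(m, w)] whose square
    is visibly [(m)], and ramification is detected by membership in [Q^2] for a maximal ideal [Q] of
    the integers of [L]. The rational integer [m] arises from the norm [n] of [a]. If [n] is not a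
    square in [F], it is the product of [a] and its conjugate, both squares in [L]. If [n = b^2],
    then [b] is rational and [a (tr a + 2 b) = (a + b)^2], so [a] differs from a rational number by
    a square factor unless it is rational itself. *)

Lemma nat_sqrt (n : nat) : exists m : nat, (m ^ 2 <= n < m.+1 ^ 2)%N.
Proof.
elim: n => [|n [m /andP[m1 m2]]]; first by exists 0%N.
have [h|h] := ltnP n.+1 (m.+1 ^ 2)%N; first by exists m; nia.
by exists m.+1; nia.
Qed.

(** Zero counts as a square, and the modulus may be composite or negative, in contrast with the
    value 1 of the Legendre symbol. *)
Definition square_mod (m a : int) : Prop := exists x : int, (m %| x ^+ 2 - a)%Z.

Lemma absz_modz_lt (m : nat) (u : int) : (0 < m)%N -> (`|(u %% m%:Z)%Z| < m)%N.
Proof.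
by move=> m0; have := modz_ge0 u (d := m%:Z); have := ltz_pmod u (d := m%:Z); lia.
Qed.

Lemma eq_absz_modz (m : nat) (u v : int) : (0 < m)%N ->
  `|(u %% m%:Z)%Z|%N = `|(v %% m%:Z)%Z|%N -> (m%:Z %| u - v)%Z.
Proof.
move=> m0 e; rewrite -eqz_mod_dvd; apply/eqP.
have m1 : m%:Z != 0 by lia.
by rewrite -(gez0_abs (modz_ge0 u m1)) -(gez0_abs (modz_ge0 v m1)) e.
Qed.

Lemma sqr_distz_ord (n m : nat) (i j : 'I_n.+1) :
  (n ^ 2 <= m)%N -> (i%:Z - j%:Z) ^+ 2 <= m%:Z.
Proof.
move=> h; have := ltn_ord i; have := ltn_ord j; rewrite !ltnS => hj hi.
apply: (@le_trans _ _ ((n ^ 2)%N%:Z)); last by rewrite lez_nat.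
by clear h; nia.
Qed.

(** Pigeonhole on a box whose sides are the square roots of [A * |B|], [|B|] and [A]: it holds more
    than [A * |B|] points, which is the number of pairs of residues of [x - s z] modulo [A] and
    [x - t y] modulo [B]. *)
Lemma small_solution (A B s t : int) : 0 < A -> B != 0 ->
  exists x y z : int, [/\ (x, y, z) != (0, 0, 0),
    (A %| x - s * z)%Z, (B %| x - t * y)%Z,
    x ^+ 2 <= A * `|B| & y ^+ 2 <= `|B| /\ z ^+ 2 <= A].
Proof.
move=> A0 B0.
have [a eA] : exists a : nat, A = a%:Z by exists `|A|%N; lia.
have [b eB] : exists b : nat, `|B| = b%:Z by exists `|B|%N; lia.
have a0 : (0 < a)%N by lia.
have b0 : (0 < b)%N by lia.
have dB u : (B %| u)%Z = (b%:Z %| u)%Z.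
  by rewrite -eB !dvdzE; congr (_ %| _)%N; lia.
suff [x [y [z [h1 h2 h3 h4 h5]]]] : exists x y z : int, [/\ (x, y, z) != (0, 0, 0),
    (a%:Z %| x - s * z)%Z, (b%:Z %| x - t * y)%Z,
    x ^+ 2 <= a%:Z * b%:Z & y ^+ 2 <= b%:Z /\ z ^+ 2 <= a%:Z].
  by exists x, y, z; rewrite dB eA eB.
clear dB eB eA A0 B0.
have [X /andP[X1 X2]] := nat_sqrt (a * b)%N.
have [Y /andP[Y1 Y2]] := nat_sqrt b.
have [Z /andP[Z1 Z2]] := nat_sqrt a.
pose f (v : 'I_X.+1 * 'I_Y.+1 * 'I_Z.+1) : 'I_a * 'I_b :=
  (Ordinal (absz_modz_lt (v.1.1%:Z - s * v.2%:Z) a0),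
   Ordinal (absz_modz_lt (v.1.1%:Z - t * v.1.2%:Z) b0)).
have nf : ~~ injectiveb f.
  apply/injectiveP => /leq_card; rewrite !card_prod !card_ord => h.
  (* The counts are compared after squaring, since only the squares of the integer roots have exact
     bounds. *)
  have : ((X.+1 * Y.+1 * Z.+1) ^ 2 <= (a * b) ^ 2)%N by rewrite leq_sqr.
  rewrite !expnMn => h2.
  have := ltn_mul (ltn_mul X2 Y2) Z2.
  by rewrite ltnNge (_ : (a * b * b * a = a ^ 2 * b ^ 2)%N) ?h2 //; ring.
case/injectivePn: nf => -[[x y] z] [[[x' y'] z'] uv] [h1 h2].
exists (x%:Z - x'%:Z), (y%:Z - y'%:Z), (z%:Z - z'%:Z); split.
- apply: contraNneq uv => -[/eqP e1 /eqP e2 /eqP e3].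
  rewrite !subr_eq0 !eqz_nat in e1 e2 e3.
  by rewrite !xpair_eqE -!val_eqE /= e1 e2 e3.
- have := eq_absz_modz a0 h1.
  by rewrite (_ : _ - _ - _ = x%:Z - x'%:Z - s * (z%:Z - z'%:Z)) //; ring.
- have := eq_absz_modz b0 h2.
  by rewrite (_ : _ - _ - _ = x%:Z - x'%:Z - t * (y%:Z - y'%:Z)) //; ring.
- exact: sqr_distz_ord.
- by split; apply: sqr_distz_ord.
Qed.

(* A short vector of a lattice of index [A * |B|] on which the form vanishes modulo
   [A * B] takes the value [0] or [- A * B]. *)
Lemma ternary_isotropic (A B : int) : 0 < A -> B != 0 -> coprimez A B ->
  (forall u : int, u ^+ 2 != `|B|) -> (forall u : int, u ^+ 2 != A * `|B|) ->
  square_mod A B -> square_mod B A ->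
  exists x y z : int, (x, y, z) != (0, 0, 0) /\ x ^+ 2 = A * y ^+ 2 + B * z ^+ 2.
Proof.
move=> A0 B0 cAB nB nAB [s hs] [t ht].
have [x [y [z [nz h1 h2 hx [hy hz]]]]] := small_solution s t A0 B0.
pose V := x ^+ 2 - B * z ^+ 2 - A * y ^+ 2.
have : (A * B %| V)%Z.
  rewrite Gauss_dvdz //; apply/andP; split.
    rewrite (_ : V = (x - s * z) * (x + s * z) + (s ^+ 2 - B) * z ^+ 2 + A * (- y ^+ 2)).
      by rewrite !rpredD ?dvdz_mulr ?dvdz_mull // .
    by rewrite /V; ring.
  rewrite (_ : V = (x - t * y) * (x + t * y) + (t ^+ 2 - A) * y ^+ 2 + B * (- z ^+ 2)).
    by rewrite !rpredD ?dvdz_mulr ?dvdz_mull //.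
  by rewrite /V; ring.
case/dvdzP => k hk.
have xlt : x ^+ 2 < A * `|B| by rewrite lt_neqAle nAB hx.
have ylt : y ^+ 2 < `|B| by rewrite lt_neqAle nB hy.
(* The box confines [V] strictly between [-2 A B] and [A B] if [B > 0], and strictly between [A B]
   and [-2 A B] if [B < 0]. The strict inequalities come from the two nonsquare hypotheses. *)
have [V0|VAB] : V = 0 \/ V = - (A * B).
  clear h1 h2 hs ht cAB nB nAB.
  have x0 := sqr_ge0 x; have y0 := sqr_ge0 y; have z0 := sqr_ge0 z.
  move: hk; rewrite /V; move: (x ^+ 2) (y ^+ 2) (z ^+ 2) x0 y0 z0 xlt ylt hz {V hx hy nz}.
  move=> X Y Z X0 Y0 Z0 hX hY hZ e; rewrite e.
  have P0 : 0 < A * `|B| by rewrite mulr_gt0 ?normr_gt0.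
  have hAY : A * Y < A * `|B| by rewrite ltr_pM2l.
  have hBZ : `|B| * Z <= A * `|B| by rewrite mulrC ler_pM2r ?normr_gt0.
  have hAY0 : 0 <= A * Y by rewrite mulr_ge0 // ltW.
  have hBZ0 : 0 <= `|B| * Z by rewrite mulr_ge0.
  suff : k = 0 \/ k = -1 by case=> ->; [left | right]; rewrite ?mul0r ?mulN1r.
  have [Bp|Bn] : 0 < B \/ B < 0 by clear -B0; lia.
    have e1 : `|B| = B by clear -Bp; lia.
    rewrite e1 in P0 hX hY hAY hBZ hBZ0.
    have k1 : k * (A * B) < 1 * (A * B) by rewrite -e; lra.
    have k2 : - 2 * (A * B) < k * (A * B) by rewrite -e; lra.
    by move: k1 k2; rewrite !ltr_pM2r //; lia.
  have e1 : `|B| = - B by clear -Bn; lia.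
  rewrite e1 in P0 hX hY hAY hBZ hBZ0.
  have e2 : X - B * Z - A * Y = - k * (A * - B) by rewrite e; ring.
  have k1 : - k * (A * - B) < 2 * (A * - B) by rewrite -e2; lra.
  have k2 : - 1 * (A * - B) < - k * (A * - B) by rewrite -e2; lra.
  by move: k1 k2; rewrite !ltr_pM2r //; lia.
- exists x, y, z; split=> //.
  by move: V0; rewrite /V => /eqP; rewrite subr_eq0 subr_eq => /eqP ->; rewrite addrC.
(* Here the multiplier [y ^+ 2 - B] of the general case vanishes, but [B] is then a square and a
   solution is immediate. *)
have [yB|yB] := eqVneq (y ^+ 2) B.
  exists y, 0, 1; split; last by rewrite yB; ring.
  by rewrite !xpair_eqE oner_eq0 !andbF.
(* [x^2 - B z^2 = A (y^2 - B)]: multiply both sides by the norm [y^2 - B]. *)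
exists (x * y + B * z), (y ^+ 2 - B), (x + y * z); split.
  by apply: contraNneq yB => -[_ /eqP]; rewrite subr_eq0.
have -> : (x * y + B * z) ^+ 2 =
  V * (y ^+ 2 - B) + B * (x + y * z) ^+ 2 + A * y ^+ 2 * (y ^+ 2 - B).
  by rewrite /V; ring.
by rewrite VAB; ring.
Qed.

Lemma intr_Fp_eq0 (p : nat) (m : int) : prime p ->
  (m%:~R == 0 :> 'F_p) = (p%:Z %| m)%Z.
Proof.
by move=> pp; rewrite (dvdz_pcharf (pchar_Fp pp)).
Qed.

Lemma square_modP (p : nat) (m : int) : prime p ->
  square_mod p m <-> exists x : 'F_p, x ^+ 2 = m%:~R.
Proof.
move=> pp; split=> [[x]|[x e]].
  rewrite -intr_Fp_eq0 // rmorphB rmorphXn subr_eq0 => /eqP <-.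
  by exists x%:~R.
exists (x : nat)%:Z; rewrite -intr_Fp_eq0 // rmorphB rmorphXn /=.
by rewrite -pmulrn natr_Zp e subrr.
Qed.

(** * Squares modulo a prime congruent to 3 modulo 4 *)

Section ThreeModFour.
Variables (p : nat) (p_prime : prime p) (p_mod4 : p = 3 %[mod 4]).

Let e := (p./2)%N.
Lemma p_half : (p = e.*2.+1)%N /\ odd e.
Proof. by rewrite /e; move: p_mod4; split; lia. Qed.

Lemma Fp_exp_half (x : 'F_p) : x != 0 -> x ^+ e = 1 \/ x ^+ e = -1.
Proof.
move=> x0.
have h : x ^+ p = x by rewrite -[in X in _ ^+ X](card_Fp p_prime) expf_card.
have : (x ^+ e) ^+ 2 == 1.
  rewrite -exprM muln2; apply/eqP/(mulfI x0).
  by rewrite -exprS -(proj1 p_half) h mulr1.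
by rewrite sqrf_eq1 => /orP[] /eqP ->; [left | right].
Qed.

(** As [e = (p - 1) / 2] is odd, the power of [x] with exponent [(e + 1) / 2] exists, and its square
    is [x * x ^+ e], which is [x] or [-x]. *)
Lemma Fp_square_or_opp (x : 'F_p) : exists y : 'F_p, y ^+ 2 = x \/ y ^+ 2 = - x.
Proof.
have [->|x0] := eqVneq x 0; first by exists 0; left; rewrite expr0n.
have oe := proj2 p_half.
exists (x ^+ (e.+1)./2); rewrite -exprM (_ : (e.+1./2 * 2 = e.+1)%N); last by lia.
by rewrite exprS; case: (Fp_exp_half x0) => ->; rewrite ?mulr1 ?mulrN1; [left|right].
Qed.

(** A square root [x] of [-1] would give [x ^+ (p - 1) = (-1) ^+ e = -1], against Fermat. *)
Lemma Fp_sqr_neqN1 (x : 'F_p) : x ^+ 2 != -1.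
Proof.
apply/eqP => h.
have x0 : x != 0.
  by apply: contra_eq_neq h => ->; rewrite expr0n eq_sym oppr_eq0 oner_eq0.
have : x ^+ p = x by rewrite -[in X in _ ^+ X](card_Fp p_prime) expf_card.
rewrite [X in x ^+ X](proj1 p_half) exprS -mul2n exprM h => /eqP.
rewrite -[X in _ == X]mulr1 (inj_eq (mulfI x0)) -signr_odd (proj2 p_half) expr1.
rewrite eq_sym -subr_eq0 opprK -[1 + 1]/(2%:R) -(dvdn_pcharf (pchar_Fp p_prime)).
by move=> /dvdn_leq; move: p_mod4; clear; lia.
Qed.

Lemma square_mod_or_opp (m : int) : square_mod p m \/ square_mod p (- m).
Proof.
have [y [h|h]] := Fp_square_or_opp m%:~R; [left|right]; apply/square_modP => //;
  by exists y; rewrite ?rmorphN.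
Qed.

Lemma square_mod_opp_dvd (m : int) :
  square_mod p m -> square_mod p (- m) -> (p %| m)%Z.
Proof.
move=> /(square_modP _ p_prime)[x hx] /(square_modP _ p_prime)[y hy].
rewrite -intr_Fp_eq0 //; apply: contraT => m0.
have x0 : x != 0 by apply: contraNneq m0 => x0; rewrite -hx x0 expr0n.
have /eqP := Fp_sqr_neqN1 (y / x); case.
by rewrite expr_div_n hy hx rmorphN mulNr divff.
Qed.

Lemma square_modM_nonres (a b : int) :
  ~ square_mod p a -> ~ square_mod p b -> square_mod p (a * b).
Proof.
move=> ha hb.
have [//|/(square_modP _ p_prime)[x hx]] := square_mod_or_opp a.
have [//|/(square_modP _ p_prime)[y hy]] := square_mod_or_opp b.
by apply/(square_modP _ p_prime); exists (x * y); rewrite exprMn hx hy -rmorphM mulrNN.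
Qed.
End ThreeModFour.

Lemma square_mod2 (m : int) : square_mod 2 m.
Proof.
have [k [->|->]] : exists k, m = 2 * k \/ m = 2 * k + 1 by exists (m %/ 2)%Z; lia.
  by exists 0; apply/dvdzP; exists (- k); ring.
by exists 1; apply/dvdzP; exists (- k); ring.
Qed.

Lemma square_modMl (a b m : int) : coprimez a b ->
  square_mod a m -> square_mod b m -> square_mod (a * b) m.
Proof.
move=> cab [x hx] [y hy]; exists (zchinese a b x y).
have split_sqr (z u v : int) : (v %| z - u)%Z -> (v %| u ^+ 2 - m)%Z -> (v %| z ^+ 2 - m)%Z.
  move=> h1 h2; rewrite (_ : z ^+ 2 - m = (z - u) * (z + u) + (u ^+ 2 - m)); last by ring.
  by rewrite rpredD ?dvdz_mulr.
rewrite Gauss_dvdz //; apply/andP; split; [apply: split_sqr hx | apply: split_sqr hy];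
  by rewrite -eqz_mod_dvd ?zchinese_modl ?zchinese_modr.
Qed.

(** Infinite descent on [|x| + |y| + |z|]: a solution divided by [m] is again a solution. *)
Lemma descent_zero (A B m : int) : 1 < m ->
  (forall x y z : int, x ^+ 2 = A * y ^+ 2 + B * z ^+ 2 ->
    [/\ (m %| x)%Z, (m %| y)%Z & (m %| z)%Z]) ->
  forall x y z : int, x ^+ 2 = A * y ^+ 2 + B * z ^+ 2 -> (x, y, z) = (0, 0, 0).
Proof.
move=> m1 H x y z.
have [n] := ubnP (`|x| + `|y| + `|z|)%N; elim: n x y z => // n IH x y z hn e.
have [/dvdzP[x' ex] /dvdzP[y' ey] /dvdzP[z' ez]] := H _ _ _ e.
have e' : x' ^+ 2 = A * y' ^+ 2 + B * z' ^+ 2.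
  have m2 : m ^+ 2 != 0 by rewrite sqrf_eq0; lia.
  by apply: (mulIf m2); rewrite -exprMn -ex e [y in A * y ^+ 2]ey [z in B * z ^+ 2]ez; ring.
have [/eqP x0|x0] := boolP ((x, y, z) == (0, 0, 0)); first by [].
suff [e1 e2 e3] : (x', y', z') = (0, 0, 0) by rewrite ex ey ez e1 e2 e3 !mul0r.
apply: IH e'.
have le1 (u : int) : (`|u| <= `|(u * m)%R|)%N by rewrite abszM leq_pmulr //; lia.
have lt1 (u : int) : u * m != 0 -> (`|u| < `|(u * m)%R|)%N.
  by rewrite mulf_eq0 negb_or => /andP[u0 _]; rewrite abszM ltn_Pmulr //; lia.
have := lt1 x'; have := lt1 y'; have := lt1 z'.
have := le1 x'; have := le1 y'; have := le1 z'; rewrite -ex -ey -ez.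
rewrite !xpair_eqE in x0; clear - hn x0.
by move: `|x'|%N `|y'|%N `|z'|%N => x1 y1 z1; lia.
Qed.

Lemma sqr_mod8 (x : int) : exists k,
  ((2 %| x)%Z /\ (x ^+ 2 = 8 * k \/ x ^+ 2 = 8 * k + 4)) \/ x ^+ 2 = 8 * k + 1.
Proof.
have [k [->|[->|[->|->]]]] : exists k, x = 4 * k \/ x = 4 * k + 1 \/ x = 4 * k + 2 \/ x = 4 * k + 3.
- by exists (x %/ 4)%Z; lia.
- by exists (2 * k ^+ 2); left; split; [lia | left; ring].
- by exists (2 * k ^+ 2 + k); right; ring.
- by exists (2 * k ^+ 2 + 2 * k); left; split; [lia | right; ring].
- by exists (2 * k ^+ 2 + 3 * k + 1); right; ring.
Qed.

Lemma prime_mul_nonsquare (p : nat) (m : int) : prime p -> ~~ (p %| m)%Z ->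
  forall u : int, u ^+ 2 != p%:Z * m.
Proof.
move=> pp pm u; apply: contraNneq pm => e.
have pu : (p %| u)%Z.
  have : (p %| u ^+ 2)%Z by rewrite e dvdz_mulr.
  by rewrite !dvdzE abszX Euclid_dvdX // => /andP[].
case/dvdzP: pu e => v ->; rewrite [X in _ = X]mulrC exprMn expr2 mulrA.
have p0 : p%:Z != 0 by have := prime_gt0 pp; lia.
by move/(mulIf p0) => <-; rewrite dvdz_mull.
Qed.

(** Modulo 4 the equation says that three squares sum to 0, which forces all three to be even. *)
Lemma no_isotropic_mod4 (A B : int) :
  (A = 3 %[mod 4])%Z -> (B = 3 %[mod 4])%Z ->
  forall x y z : int, x ^+ 2 = A * y ^+ 2 + B * z ^+ 2 -> (x, y, z) = (0, 0, 0).
Proof.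
move=> hA hB; apply: (@descent_zero _ _ 2) => // x y z.
have [a ->] : exists a, A = 4 * a + 3 by exists (A %/ 4)%Z; lia.
have [b ->] : exists b, B = 4 * b + 3 by exists (B %/ 4)%Z; lia.
have [k hk] := sqr_mod8 x; have [l hl] := sqr_mod8 y; have [m hm] := sqr_mod8 z.
move: (x ^+ 2) (y ^+ 2) (z ^+ 2) hk hl hm => X Y Z hk hl hm e.
suff : (2 %| x)%Z /\ (2 %| y)%Z /\ (2 %| z)%Z by case=> ? [].
have {}e : X = 4 * (a * Y + b * Z) + 3 * Y + 3 * Z by rewrite e; ring.
by move: (a * Y + b * Z) e => w e; lia.
Qed.

(** The obstruction at 2 behind the supplementary laws for 2 and -2. Since [A] is odd and [B] even,
    [x] and [y] have the same parity; if both are odd, reduction modulo 8 gives [z ^+ 2 = 3] modulo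
    4, and if both are even so is [z]. *)
Lemma no_isotropic_mod8 (A B : int) :
  (A = 3 %[mod 8])%Z /\ (B = 2 %[mod 8])%Z \/ (A = 7 %[mod 8])%Z /\ (B = -2 %[mod 8])%Z ->
  forall x y z : int, x ^+ 2 = A * y ^+ 2 + B * z ^+ 2 -> (x, y, z) = (0, 0, 0).
Proof.
move=> hAB; apply: (@descent_zero _ _ 2) => // x y z.
have [k hk] := sqr_mod8 x; have [l hl] := sqr_mod8 y; have [m hm] := sqr_mod8 z.
move: (x ^+ 2) (y ^+ 2) (z ^+ 2) hk hl hm => X Y Z hk hl hm e.
suff : (2 %| x)%Z /\ (2 %| y)%Z /\ (2 %| z)%Z by case=> ? [].
have [[a [b [eA eB]]]|[a [b [eA eB]]]] :
    (exists a b, A = 8 * a + 3 /\ B = 8 * b + 2) \/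
    (exists a b, A = 8 * a + 7 /\ B = 8 * b + 6).
- by case: hAB => [[h1 h2]|[h1 h2]]; [left|right]; exists (A %/ 8)%Z, (B %/ 8)%Z; lia.
- have {}e : X = 8 * (a * Y + b * Z) + 3 * Y + 2 * Z by rewrite e eA eB; ring.
  by move: (a * Y + b * Z) e => w e; clear hAB eA eB; lia.
have {}e : X = 8 * (a * Y + b * Z) + 7 * Y + 6 * Z by rewrite e eA eB; ring.
by move: (a * Y + b * Z) e => w e; clear hAB eA eB; lia.
Qed.

(** * Quadratic reciprocity *)

(** The field with [q ^ (p - 1)] elements works: by Fermat [p] divides the order of its unit group,
    and Cauchy's theorem gives an element of order [p]. *)
Lemma finfield_prim_root (p q : nat) : prime p -> prime q -> p != q ->
  exists (K : finFieldType) (z : K), q \in [pchar K] /\ (z ^+ p = 1 /\ z != 1).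
Proof.
move=> pp qp npq.
have p1 : (0 < p.-1)%N by have := prime_gt1 pp; lia.
have [K chK cardK] := pPrimePowerField qp p1.
have dv : (p %| #|[set: {unit K}]%G|)%N.
  rewrite card_finField_unit cardK -subn1 -eqn_mod_dvd ?expn_gt0 ?prime_gt0 //.
  rewrite -(totient_prime pp); apply/eqP/Euler_exp_totient.
  by rewrite prime_coprime // dvdn_prime2 // eq_sym.
have [x _ ox] := Cauchy pp dv.
exists K, (val x); split=> //; split.
  by rewrite -FinRing.val_unitX -ox expg_order.
have := prime_gt1 pp; rewrite -ox order_gt1; apply: contraNneq => h.
by apply/eqP/val_inj.
Qed.

Section GaussSum.
Variables (p : nat) (p_prime : prime p) (p_mod4 : p = 3 %[mod 4]).
Variables (K : fieldType) (z : K) (zp : z ^+ p = 1) (z1 : z != 1).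

(** The additive character of the prime field attached to the root of unity [z]. *)
Definition expFp (a : 'F_p) : K := z ^+ (a : nat).

Lemma expFp_nat (n : nat) : expFp n%:R = z ^+ n.
Proof. by rewrite /expFp val_Fp_nat // expr_mod. Qed.

Lemma expFpD (a b : 'F_p) : expFp (a + b) = expFp a * expFp b.
Proof. by rewrite -[a]natr_Zp -[b]natr_Zp -natrD !expFp_nat exprD. Qed.

Lemma sum_expFp : \sum_a expFp a = 0.
Proof.
have h : \sum_a expFp a = z * \sum_a expFp a.
  rewrite [LHS](reindex_inj (addrI 1)) mulr_sumr; apply: eq_bigr => a _.
  by rewrite expFpD -[1]/(1%:R) expFp_nat.
have : (1 - z) * (\sum_a expFp a) = 0 by rewrite mulrBl mul1r -h subrr.
by move/eqP; rewrite mulf_eq0 subr_eq0 eq_sym (negbTE z1) => /eqP.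
Qed.

Lemma sum_expFpM (a : 'F_p) : \sum_b expFp (a * b) = (if a == 0 then p%:R else 0).
Proof.
have [->|a0] := eqVneq a 0.
  rewrite (eq_bigr (fun=> 1)) => [|b _]; last by rewrite mul0r.
  by rewrite sumr_const card_Fp.
by rewrite -[RHS]sum_expFp [RHS](reindex_inj (mulfI a0)).
Qed.

(* Equal to the sum of the values of the quadratic character times [z ^+ x], but
   defined without that character. *)
Definition gauss_sum := \sum_(x : 'F_p) expFp (x ^+ 2).
Definition gauss_sumN := \sum_(x : 'F_p) expFp (- x ^+ 2).

(** With [n a] the number of square roots of [a], the sum is that of [(n a + n (- a)) z^a]. Exactly
    one of [a] and [-a] is a square when [a] is nonzero, so the weight is constantly 2 and the
    character sums to zero. *)
Lemma gauss_sumD : gauss_sum + gauss_sumN = 0.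
Proof.
pose n (a : 'F_p) := #|[pred x : 'F_p | x ^+ 2 == a]|.
have part (h : 'F_p -> K) : \sum_(x : 'F_p) h (x ^+ 2) = \sum_a h a *+ n a.
  rewrite (partition_big (fun x : 'F_p => x ^+ 2) xpredT) //=.
  apply: eq_bigr => a _; rewrite -sumr_const.
  by apply: eq_big => x //= /eqP ->.
have n_sq (b : 'F_p) : b != 0 -> n (b ^+ 2) = 2.
  move=> b0; rewrite /n (eq_card (B := pred2 b (- b))).
    rewrite card2 (_ : (b == - b) = false) //.
    rewrite -addr_eq0 -mulr2n -(mulr_natr b) mulf_eq0 (negbTE b0) /=.
    rewrite -(dvdn_pcharf (pchar_Fp p_prime)).
    by apply/negP => /dvdn_leq; move: p_mod4; clear; lia.
  by move=> x; rewrite !inE eqf_sqr.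
have n_nsq (a : 'F_p) : (forall x, x ^+ 2 != a) -> n a = 0%N.
  by move=> h; apply: eq_card0 => x; rewrite !inE; apply/negbTE/h.
have n2 (a : 'F_p) : (n a + n (- a) = 2)%N.
  have [->|a0] := eqVneq a 0.
    rewrite oppr0 (_ : n 0 = 1%N) // /n (eq_card (B := pred1 0)) ?card1 // => x.
    by rewrite !inE sqrf_eq0.
  have aux (b c : 'F_p) : b != 0 -> c ^+ 2 = b -> (n b + n (- b) = 2)%N.
    move=> b0 e; have c0 : c != 0 by apply: contraNneq b0 => c0; rewrite -e c0 expr0n.
    rewrite -e n_sq // n_nsq // => x; apply/eqP => h.
    have /eqP := Fp_sqr_neqN1 p_prime p_mod4 (x / c); case.
    by rewrite expr_div_n h mulNr divff // expf_neq0.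
  have [c [e|e]] := Fp_square_or_opp p_prime p_mod4 a; first exact: aux e.
  by rewrite addnC -[in X in (_ + X)%N](opprK a); apply: aux e; rewrite oppr_eq0.
rewrite /gauss_sum /gauss_sumN (part expFp) (part (fun a => expFp (- a))).
rewrite [X in _ + X](reindex_inj oppr_inj) /= -big_split /=.
rewrite (eq_bigr (fun a => expFp a *+ 2)) => [|a _].
  by rewrite sumrMnl sum_expFp mul0rn.
by rewrite opprK -mulrnDr n2.
Qed.

(** Putting [x = y + u] turns [x^2 - y^2] into [u (2 y + u)]; summing over [y] first kills every
    term with [u] nonzero. *)
Lemma gauss_sumM : gauss_sum * gauss_sumN = p%:R.
Proof.
have n2 : (2%:R : 'F_p) != 0.
  rewrite -(dvdn_pcharf (pchar_Fp p_prime)).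
  by apply/negP => /dvdn_leq; move: p_mod4; clear; lia.
rewrite /gauss_sum mulr_suml /gauss_sumN.
transitivity (\sum_(v : 'F_p) \sum_(u : 'F_p) expFp (u * (2%:R * v + u))).
  rewrite exchange_big /=.
  rewrite (eq_bigr (fun x : 'F_p => \sum_y expFp (x ^+ 2 - y ^+ 2))); last first.
    by move=> x _; rewrite mulr_sumr; apply: eq_bigr => y _; rewrite expFpD.
  rewrite exchange_big /= [RHS]exchange_big /=; apply: eq_bigr => y _.
  rewrite (reindex_inj (addrI y)) /=; apply: eq_bigr => u _.
  by congr expFp; ring.
rewrite exchange_big /= (eq_bigr (fun u => if u == 0 then p%:R else 0)) => [|u _].
  by rewrite -big_mkcond big_pred1_eq.
rewrite (eq_bigr (fun v => expFp (u * 2%:R * v) * expFp (u ^+ 2))); last first.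
  by move=> v _; rewrite -expFpD; congr expFp; ring.
rewrite -mulr_suml sum_expFpM mulf_eq0 (negbTE n2) orbF.
by case: eqVneq => [->|_]; rewrite ?mul0r // expr0n mulr1.
Qed.

Lemma gauss_sum_sqr : gauss_sum ^+ 2 = - p%:R.
Proof.
have /eqP := gauss_sumD; rewrite addrC addr_eq0 => /eqP e.
by rewrite -gauss_sumM e mulrN opprK expr2.
Qed.

(** Frobenius replaces [x^2] by [q x^2] in the exponent. As [q] is not a square, [-q = c^2], hence
    [q x^2 = -(c x)^2] and the sum turns into [gauss_sumN], its opposite. *)
Lemma gauss_sum_frob (q : nat) : q \in [pchar K] -> prime q -> p != q ->
  ~ square_mod p q -> gauss_sum ^+ q = - gauss_sum.
Proof.
move=> chK qp npq hq.
have [//|/(square_modP _ p_prime)[c hc]] := square_mod_or_opp p_prime p_mod4 q.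
have c0 : c != 0.
  apply: contraNneq npq => c0; rewrite c0 expr0n /= rmorphN /= in hc.
  have : (q%:R : 'F_p) == 0 by rewrite -oppr_eq0 -hc.
  by rewrite -(dvdn_pcharf (pchar_Fp p_prime)) dvdn_prime2.
have /eqP := gauss_sumD; rewrite addrC addr_eq0 => /eqP <-.
rewrite -(pFrobenius_autE chK) /gauss_sum rmorph_sum /=.
rewrite /gauss_sumN [RHS](reindex_inj (mulfI c0)) /=; apply: eq_bigr => x _.
rewrite pFrobenius_autE [in LHS]/expFp -exprM -expFp_nat natrM natr_Zp; congr expFp.
by rewrite exprMn hc rmorphN /= mulNr opprK mulrC.
Qed.
End GaussSum.

(** If [p] were not a square modulo [q], then [-p = u^2] there. The Gauss sum [g] also has square
    [-p], so [g = u] or [g = -u] lies in the prime field and is fixed by Frobenius, whereas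
    Frobenius changes its sign. *)
Lemma square_mod_recip (p q : nat) : prime p -> prime q -> p != q ->
  p = 3 %[mod 4] -> q = 3 %[mod 4] -> ~ square_mod p q -> square_mod q p.
Proof.
move=> pp qp npq p4 q4 hpq.
have [//|[u]] := square_mod_or_opp qp q4 p.
have [K [z [chK [zp z1]]]] := finfield_prim_root pp qp npq.
rewrite (dvdz_pcharf chK) rmorphB rmorphXn rmorphN /= opprK addr_eq0.
have frob := gauss_sum_frob pp p4 zp z1 chK qp npq hpq.
have sq := gauss_sum_sqr pp p4 zp z1.
move: (gauss_sum _ _) frob sq => g frob sq /eqP; rewrite -[RHS]sq => /eqP.
rewrite eq_sym eqf_sqr => /orP h.
have gq : g ^+ q = g.
  by case: h => /eqP ->; rewrite -(pFrobenius_autE chK) ?rmorphN rmorph_int.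
have : g *+ 2 == 0 by rewrite mulr2n -{1}gq frob addNr.
rewrite -mulr_natr mulf_eq0 -(dvdn_pcharf chK) => /orP[/eqP g0|].
  move/eqP: sq; rewrite g0 expr0n eq_sym oppr_eq0 -(dvdn_pcharf chK).
  by rewrite dvdn_prime2 // eq_sym (negbTE npq).
by move/dvdn_leq; move: q4; clear; lia.
Qed.

Lemma square_modN (m a : int) : square_mod m a -> square_mod (- m) a.
Proof. by case=> x h; exists x; move: h; rewrite !dvdzE abszN. Qed.

Lemma prime_nonsquare (p : nat) : prime p -> forall u : int, u ^+ 2 != p.
Proof.
move=> pp u; rewrite -[p%:Z]mulr1; apply: prime_mul_nonsquare => //.
by rewrite dvdzE /= dvdn1; have := prime_gt1 pp; lia.
Qed.

Lemma primes_mul_nonsquare (p q : nat) : prime p -> prime q -> p != q ->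
  forall u : int, u ^+ 2 != p%:Z * q%:Z.
Proof.
by move=> pp qp npq; apply: prime_mul_nonsquare => //; rewrite dvdzE /= dvdn_prime2.
Qed.

Lemma coprimez_primes (p q : nat) : prime p -> prime q -> p != q -> coprimez p q.
Proof. by move=> pp qp npq; rewrite coprimezE /= prime_coprime // dvdn_prime2. Qed.

(** This is the statement that [-q] is a norm from Q(sqrt p). The condition at [p] holds because [q]
    is a nonresidue, the one at [q] by reciprocity. *)
Lemma norm_solution (p q : nat) : prime p -> prime q -> p != q ->
  p = 3 %[mod 4] -> q = 3 %[mod 4] -> ~ square_mod p q ->
  exists x y z : int, (x, y, z) != (0, 0, 0) /\ x ^+ 2 = p%:Z * y ^+ 2 + - q%:Z * z ^+ 2.
Proof.
move=> pp qp npq p4 q4 h; have p0 := prime_gt0 pp; have q0 := prime_gt0 qp.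
apply: ternary_isotropic; rewrite ?oppr_eq0 ?normrN ?coprimezN ?coprimez_primes //.
- by lia.
- exact: prime_nonsquare.
- exact: primes_mul_nonsquare.
- by case: (square_mod_or_opp pp p4 q).
- by apply: square_modN; apply: square_mod_recip.
Qed.

(** Everything is a square modulo 2, so the condition at [p] is the only one left. *)
Lemma square_mod_pm2_solution (p : nat) (e : int) : prime p -> odd p -> e = 2 \/ e = -2 ->
  square_mod p e ->
  exists x y z : int, (x, y, z) != (0, 0, 0) /\ x ^+ 2 = p%:Z * y ^+ 2 + e * z ^+ 2.
Proof.
move=> pp op he h; have p0 := prime_gt0 pp; have p2 : p != 2%N by apply: contraTneq op => ->.
have e2 : `|e| = 2%N by case: he => ->.
apply: ternary_isotropic => //.
- by case: he => ->.
- by case: he => ->; rewrite ?coprimezN coprimez_primes.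
- by rewrite e2; apply: prime_nonsquare.
- by rewrite e2; apply: primes_mul_nonsquare.
- by case: he => ->; [|apply: square_modN]; apply: square_mod2.
Qed.

(** A square root would make the ternary form isotropic by Legendre's theorem, which reduction
    modulo 8 forbids. *)
Lemma nonsquare_mod8 (p : nat) (e : int) : prime p ->
  p = 3 %[mod 8] /\ e = 2 \/ p = 7 %[mod 8] /\ e = -2 -> ~ square_mod p e.
Proof.
move=> pp he h.
have [||x [y [z [nz eq]]]] := square_mod_pm2_solution pp _ _ h.
- by clear h; case: he => [[p8 _]|[p8 _]]; lia.
- by case: he => [[_ ->]|[_ ->]]; [left|right].
move/eqP: nz; apply; apply: no_isotropic_mod8 eq.
by clear h; case: he => [[p8 ->]|[p8 ->]]; [left|right]; split=> //; lia.
Qed.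

Lemma solution_mod8_7 (p : nat) : prime p -> p = 7 %[mod 8] ->
  exists x y z : int, (x, y, z) != (0, 0, 0) /\ x ^+ 2 = p%:Z * y ^+ 2 + 2 * z ^+ 2.
Proof.
move=> pp p8; apply: square_mod_pm2_solution => //; [by lia | by left |].
have p4 : p = 3 %[mod 4] by lia.
case: (square_mod_or_opp pp p4 2) => // h.
by case: (@nonsquare_mod8 p (-2) pp) => //; right.
Qed.

Lemma solution_mod8_3 (p : nat) : prime p -> p = 3 %[mod 8] ->
  exists x y z : int, (x, y, z) != (0, 0, 0) /\ x ^+ 2 = p%:Z * y ^+ 2 + -2 * z ^+ 2.
Proof.
move=> pp p8; apply: square_mod_pm2_solution => //; [by lia | by right |].
have p4 : p = 3 %[mod 4] by lia.
case: (square_mod_or_opp pp p4 2) => // h.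
by case: (@nonsquare_mod8 p 2 pp) => //; left.
Qed.

(** The condition at [2 p] reduces to the one at [p]. At [r], the product [2 p] is a square because
    both factors are nonresidues: 2 since [r = 3] modulo 8, and [p] because otherwise
    [x^2 = p y^2 + r z^2] would be solvable, against the obstruction modulo 4. *)
Lemma solution_two_primes (p r : nat) : prime p -> prime r -> p != r ->
  p = 3 %[mod 4] -> r = 3 %[mod 8] -> square_mod p r ->
  exists x y z : int, (x, y, z) != (0, 0, 0) /\
    x ^+ 2 = 2 * p%:Z * y ^+ 2 + r%:Z * z ^+ 2.
Proof.
move=> pp rp npr p4 r8 h; have p0 := prime_gt0 pp; have r0 := prime_gt0 rp.
have r4 : r = 3 %[mod 4] by lia.
have p2 : 2%N != p by apply: contra_eq_neq p4 => <-.
have r2 : 2%N != r by apply: contra_eq_neq r4 => <-.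
apply: ternary_isotropic.
- by clear h; lia.
- by clear h; lia.
- by rewrite coprimezMl !coprimez_primes.
- exact: prime_nonsquare.
- move=> u; rewrite [`|_|]ger0_norm // -mulrA; apply: (@prime_mul_nonsquare 2) => //.
  by rewrite dvdzE abszM /= Euclid_dvdM // !dvdn_prime2 // negb_or p2.
- by apply: square_modMl => //; [rewrite coprimez_primes | apply: square_mod2].
apply: (square_modM_nonres rp r4); first by apply: nonsquare_mod8 => //; left.
move=> h'.
have [|||||||x [y [z [/eqP nz e]]]] := @ternary_isotropic p r.
- by clear h h'; lia.
- by clear h h'; lia.
- by rewrite coprimez_primes.
- exact: prime_nonsquare.
- by move=> u; rewrite [`|_|]ger0_norm //; apply: primes_mul_nonsquare.
- by [].
- by [].
by apply: nz; apply: no_isotropic_mod4 e; lia.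
Qed.

(** * Local solvability *)

Lemma dvdz_prime_mul (p : nat) (a b : int) : prime p ->
  (p %| a * b)%Z = (p %| a)%Z || (p %| b)%Z.
Proof. by move=> pp; rewrite !dvdzE abszM Euclid_dvdM. Qed.

Lemma dvdz_prime_exp2 (p : nat) (a : int) : prime p -> (p %| a ^+ 2)%Z = (p %| a)%Z.
Proof. by move=> pp; rewrite expr2 dvdz_prime_mul // orbb. Qed.

Lemma prime_inv_mod (p : nat) (a : int) : prime p -> ~~ (p %| a)%Z ->
  exists u v : int, u * p%:Z + v * a = 1.
Proof.
move=> pp pa; have : coprimez p a by rewrite coprimezE prime_coprime.
by case/coprimezP => -[u v] /= h; exists u, v.
Qed.

Lemma square_mod_exp_odd (p : nat) (d : int) : prime p -> odd p -> ~~ (p %| d)%Z ->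
  square_mod p d -> forall k, square_mod (p%:Z ^+ k) d.
Proof.
move=> pp op pd sq k.
suff [s hs] : square_mod (p%:Z ^+ k.+1) d.
  by exists s; apply: dvdz_trans hs; rewrite exprS dvdz_mull.
elim: k => [|k [s /dvdzP[c hc]]]; first by rewrite expr1.
have ps : ~~ (p %| 2 * s)%Z.
  rewrite dvdz_prime_mul // negb_or; apply/andP; split.
    by rewrite dvdzE /= dvdn_prime2 //; apply: contraTneq op => ->.
  apply: contraNN pd => /dvdzP[s' es]; apply/dvdzP.
  exists (p%:Z * s' ^+ 2 - c * p%:Z ^+ k).
  rewrite es [p%:Z ^+ k.+1]exprS in hc.
  rewrite (_ : d = (s' * p%:Z) ^+ 2 - ((s' * p%:Z) ^+ 2 - d)); last by ring.
  by rewrite hc; ring.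
have [u [v uv]] := prime_inv_mod pp ps.
(* Hensel's correction: [s ^+ 2 - d = c * p ^+ k.+1], and [v] inverts [2 * s] modulo [p]. *)
exists (s + p%:Z ^+ k.+1 * (- c * v)); apply/dvdzP.
exists (c * u + p%:Z ^+ k * (c * v) ^+ 2).
rewrite (_ : _ - d =
  (s ^+ 2 - d) + (p%:Z ^+ k.+1) * (- c * v) * (2 * s) + (p%:Z ^+ k.+1 * (c * v)) ^+ 2); last by ring.
rewrite hc (_ : c * _ = c * (u * p%:Z + v * (2 * s)) * p%:Z ^+ k.+1); last by rewrite uv mulr1.
by rewrite !exprS; ring.
Qed.

(** Hensel lifting at 2 starts modulo 8 and keeps the root odd. Correcting [s] by [2 ^+ k.+2 * c]
    changes the defect [c] to [c (1 + s)] plus an even number, which is even because [s] is odd. *)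
Lemma square_mod_exp_2 (d : int) : (d = 1 %[mod 8])%Z ->
  forall k, square_mod (2%N%:Z ^+ k) d.
Proof.
move=> d8 k.
suff [s [hs _]] : exists s : int, (2 ^+ k.+3 %| s ^+ 2 - d)%Z /\ exists t, s = 2 * t + 1.
  by exists s; apply: dvdz_trans hs; rewrite 3!exprS !mulrA dvdz_mull.
elim: k => [|k [s [/dvdzP[c hc] [t ht]]]].
  exists 1; split; last by exists 0.
  by rewrite -eqz_mod_dvd expr1n eq_sym; apply/eqP.
exists (s + 2 ^+ k.+2 * c); split; last by exists (t + 2 ^+ k.+1 * c); rewrite ht !exprS; ring.
apply/dvdzP; exists (c * (t + 1) + 2 ^+ k * c ^+ 2).
rewrite (_ : _ - d = (s ^+ 2 - d) + 2 ^+ k.+2 * c * (2 * s) + (2 ^+ k.+2 * c) ^+ 2); last by ring.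
by rewrite hc ht !exprS; ring.
Qed.

(** A finite-level form of anisotropy over the [l]-adic numbers, in terms of integers only; the
    exponent is doubled because the form is quadratic. *)
Definition anisotropic_at (l : int) (A B : int) : Prop :=
  forall (k : nat) (x y z : int), (l ^+ (k.*2) %| x ^+ 2 - A * y ^+ 2 - B * z ^+ 2)%Z ->
  [/\ (l ^+ k %| x)%Z, (l ^+ k %| y)%Z & (l ^+ k %| z)%Z].

(** Dividing the vector by [l] divides the value by [l ^+ 2], so the case [k = 1] can be
    iterated. *)
Lemma anisotropic_at_step (l A B : int) : l != 0 ->
  (forall x y z : int, (l ^+ 2 %| x ^+ 2 - A * y ^+ 2 - B * z ^+ 2)%Z ->
    [/\ (l %| x)%Z, (l %| y)%Z & (l %| z)%Z]) ->
  anisotropic_at l A B.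
Proof.
move=> l0 H; elim=> [|k IH] x y z; first by rewrite !expr0 !dvd1z.
rewrite doubleS => h.
have l2 : l ^+ 2 != 0 by rewrite sqrf_eq0.
have h2 : (l ^+ 2 %| x ^+ 2 - A * y ^+ 2 - B * z ^+ 2)%Z.
  by apply: dvdz_trans h; rewrite -[k.*2.+2]addn2 exprD dvdz_mull.
have [/dvdzP[x' ex] /dvdzP[y' ey] /dvdzP[z' ez]] := H _ _ _ h2.
have : (l ^+ k.*2 %| x' ^+ 2 - A * y' ^+ 2 - B * z' ^+ 2)%Z.
  rewrite -(dvdz_mul2r l2).
  by rewrite -exprD addn2; apply: dvdz_trans h _; rewrite ex ey ez; apply/dvdzP; exists 1; ring.
by case/IH => h3 h4 h5; rewrite ex ey ez !exprSr; split; apply: dvdz_mul.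
Qed.

(** If [p] did not divide [z], then [(x / z)^2 = q] modulo [p]. Hence [p] divides [z], then [x], and
    the remaining term [p y^2] is divisible by [p^2]. *)
Lemma anisotropic_at_prime (p : nat) (q : int) : prime p -> ~ square_mod p q ->
  anisotropic_at p p q.
Proof.
move=> pp hq; have p0 : p%:Z != 0 by have := prime_gt0 pp; lia.
apply: anisotropic_at_step => // x y z /dvdzP[c hc].
have hz : (p %| z)%Z.
  apply: contra_notT hq => pz.
  have [u [v uv]] := prime_inv_mod pp pz.
  exists (x * v); apply/dvdzP.
  exists ((c * p%:Z + y ^+ 2) * v ^+ 2 + q * u * (u * p%:Z - 2)).
  rewrite (_ : (x * v) ^+ 2 - q = (x ^+ 2 - p%:Z * y ^+ 2 - q * z ^+ 2) * v ^+ 2 +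
    p%:Z * y ^+ 2 * v ^+ 2 + q * ((v * z) ^+ 2 - 1)); last by ring.
  rewrite hc (_ : v * z = 1 - u * p%:Z); last by rewrite -uv; ring.
  by ring.
have hx : (p %| x)%Z.
  rewrite -dvdz_prime_exp2 // (_ : x ^+ 2 = (c * p%:Z + y ^+ 2) * p%:Z + q * z ^+ 2).
    by rewrite rpredD // ?dvdz_mull // dvdz_prime_exp2.
  by move: hc => /eqP; rewrite 2!subr_eq => /eqP ->; ring.
split=> //; rewrite -dvdz_prime_exp2 //.
case/dvdzP: hx hc => x' ->; case/dvdzP: hz => z' -> hc; apply/dvdzP.
exists (x' ^+ 2 - q * z' ^+ 2 - c); apply: (mulIf p0).
rewrite [RHS](_ : _ = (x' * p%:Z) ^+ 2 - q * (z' * p%:Z) ^+ 2 - c * p%:Z ^+ 2); last by ring.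
by rewrite -hc; ring.
Qed.

Lemma anisotropic_at_2 (p q : int) : (p = 3 %[mod 4])%Z -> (q = 3 %[mod 4])%Z ->
  anisotropic_at 2 p q.
Proof.
move=> hp hq; apply: anisotropic_at_step => // x y z /dvdzP[c].
have [a ->] : exists a, p = 4 * a + 3 by exists (p %/ 4)%Z; lia.
have [b ->] : exists b, q = 4 * b + 3 by exists (q %/ 4)%Z; lia.
have [k hk] := sqr_mod8 x; have [l hl] := sqr_mod8 y; have [m hm] := sqr_mod8 z.
move: (x ^+ 2) (y ^+ 2) (z ^+ 2) hk hl hm => X Y Z hk hl hm e.
suff : (2 %| x)%Z /\ (2 %| y)%Z /\ (2 %| z)%Z by case=> ? [].
have {}e : X = 4 * (c + a * Y + b * Z) + 3 * Y + 3 * Z by lra.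
by move: (c + a * Y + b * Z) e => w e; lia.
Qed.

Lemma dvdz_exp_eq0 (l n : int) : 1 < l -> (forall k : nat, (l ^+ k %| n)%Z) -> n = 0.
Proof.
move=> l1 h; apply/eqP; apply: contraT => n0.
have := dvdn_leq _ (h `|n|%N); rewrite absz_gt0 => /(_ n0).
by rewrite abszX leqNgt ltn_expl //; lia.
Qed.

(* A square root of [d] modulo every power of [l] sends solutions over [Z[sqrt d]]
   to solutions modulo powers of [l]. *)
Lemma anisotropic_quadratic (d l A B : int) : d < 0 -> 1 < l ->
  (forall k, square_mod (l ^+ k) d) -> anisotropic_at l A B ->
  forall x0 x1 y0 y1 z0 z1 : int,
  x0 ^+ 2 + d * x1 ^+ 2 = A * (y0 ^+ 2 + d * y1 ^+ 2) + B * (z0 ^+ 2 + d * z1 ^+ 2) ->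
  x0 * x1 = A * (y0 * y1) + B * (z0 * z1) -> z0 = 0.
Proof.
move=> d0 l1 sq an x0 x1 y0 y1 z0 z1 e0 e1.
(* The root [s] of [d] varies with the modulus, so [z0 + s z1] cannot be followed through all powers
   of [l]. Its product with [z0 - s z1] is congruent to the fixed integer [z0^2 - d z1^2], which is
   positive definite because [d < 0]. *)
suff /eqP : z0 ^+ 2 - d * z1 ^+ 2 = 0.
  have := sqr_ge0 z0; have : 0 <= - (d * z1 ^+ 2) by rewrite -mulNr mulr_ge0 ?sqr_ge0 //; lia.
  move=> h1 h2 h3; apply/eqP; rewrite -sqrf_eq0; clear -h1 h2 h3.
  by move: (z0 ^+ 2) (d * _) h1 h2 h3; lia.
apply: (@dvdz_exp_eq0 l) => // k.
have [s hs] := sq k.*2.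
have [|_ _ h] := an k (x0 + s * x1) (y0 + s * y1) (z0 + s * z1).
  rewrite (_ : _ - _ = (s ^+ 2 - d) * (x1 ^+ 2 - A * y1 ^+ 2 - B * z1 ^+ 2)) ?dvdz_mulr //.
  rewrite (_ : (x0 + s * x1) ^+ 2 =
    (x0 ^+ 2 + d * x1 ^+ 2) + (s ^+ 2 - d) * x1 ^+ 2 + 2 * s * (x0 * x1)); last by ring.
  by rewrite e0 e1; ring.
rewrite (_ : _ - _ = (z0 + s * z1) * (z0 - s * z1) + (s ^+ 2 - d) * z1 ^+ 2); last by ring.
rewrite rpredD // ?dvdz_mulr //; apply: dvdz_trans hs.
by rewrite -addnn exprD dvdz_mulr.
Qed.

(** * Algebraic integers *)

Section Integers.
Variable K : fieldType.

Lemma integers_int (m : int) : integers K m%:~R.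
Proof. exact: (integral_id intr m). Qed.
Lemma integers_nat (n : nat) : integers K n%:R.
Proof. exact: (integral_nat intr n). Qed.
Lemma integers0 : integers K 0. Proof. exact: (integers_nat 0). Qed.
Lemma integers1 : integers K 1. Proof. exact: (integers_nat 1). Qed.
Lemma integersD x y : integers K x -> integers K y -> integers K (x + y).
Proof. exact: integral_add. Qed.
Lemma integersM x y : integers K x -> integers K y -> integers K (x * y).
Proof. exact: integral_mul. Qed.
Lemma integersN x : integers K x -> integers K (- x).
Proof. exact: integral_opp. Qed.
Lemma integers_sum I (r : seq I) (P : pred I) (f : I -> K) :
  (forall i, P i -> integers K (f i)) -> integers K (\sum_(i <- r | P i) f i).
Proof.
move=> h; elim/big_rec: _ => [|i x Pi hx]; first exact: integers0.
by apply: integersD; auto.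
Qed.

Lemma integers_root (x : K) (p : {poly int}) :
  p \is monic -> root (map_poly intr p) x -> integers K x.
Proof. by move=> mp rp; exists p. Qed.

Lemma integers_quadratic (x : K) (t n : int) :
  x ^+ 2 = t%:~R * x - n%:~R -> integers K x.
Proof.
move=> e; apply: (@integers_root x (('X - t%:P) * 'X + n%:P)).
  rewrite monicE lead_coefDl ?size_polyC; last first.
    by rewrite size_mulX ?polyXsubC_eq0 // size_XsubC; case: (n == 0).
  by rewrite lead_coefMX lead_coefXsubC.
rewrite rmorphD rmorphM rmorphB /= !map_polyX !map_polyC /=.
by rewrite /root !hornerE mulrBl -expr2 e; apply/eqP; ring.
Qed.
Lemma integers_sqr (x : K) (m : int) : x ^+ 2 = m%:~R -> integers K x.
Proof. by move=> e; apply: (@integers_quadratic x 0 (- m)); rewrite mul0r add0r mulrNz opprK. Qed.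

End Integers.

Lemma integers_rmorph (K K' : fieldType) (f : {rmorphism K -> K'}) (x : K) :
  integers K x -> integers K' (f x).
Proof.
move=> [p mp rp]; exists p => //.
have -> : map_poly intr p = map_poly f (map_poly intr p).
  by rewrite -map_poly_comp; apply: eq_map_poly => m /=; rewrite rmorph_int.
by rewrite rmorph_root.
Qed.

Lemma integers_rat (K : fieldType) (f : {rmorphism rat -> K}) (r : rat) :
  integers K (f r) -> exists m : int, r = m%:~R.
Proof.
move=> [p mp].
have -> : map_poly intr p = map_poly f (map_poly intr p).
  by rewrite -map_poly_comp; apply: eq_map_poly => m /=; rewrite rmorph_int.
rewrite fmorph_root => rp.
have : ratr r \in Aint.
  apply: (@root_monic_Aint (map_poly ratr (map_poly intr p))).
  - by rewrite fmorph_root.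
  - by do 2!apply: monic_map.
  rewrite -map_poly_comp; apply/polyOverP => i; rewrite coef_map /= rmorph_int.
  by rewrite intr_int.
move/Cint_rat_Aint => /(_ (Crat_rat r)) /intrP[m hm]; exists m.
by apply: (fmorph_inj (ratr : {rmorphism rat -> algC})); rewrite /= hm rmorph_int.
Qed.

Lemma rat_reduced (r : rat) : exists n D : int,
  [/\ 0 < D, coprimez D n, r * D%:~R = n%:~R & (D = 1 -> r = n%:~R)].
Proof.
exists (numq r), (denq r); split=> [||//|e].
- exact: denq_gt0.
- by rewrite coprimezE coprime_sym coprime_num_den.
- by rewrite numqE.
by rewrite numqE e mulr1.
Qed.

(** All powers of the denominator of [r] divide one fixed nonzero integer. *)
Lemma rat_powers_int (r m : rat) : m != 0 ->
  (forall k, exists n : int, r ^+ k * m = n%:~R) -> exists n : int, r = n%:~R.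
Proof.
move=> m0 h; have [m' em] := h 0%N; rewrite expr0 mul1r in em.
have m'0 : m' != 0 by apply: contraNneq m0 => e; rewrite em e.
have [n [D [D0 cop eD D1]]] := rat_reduced r.
have dv (k : nat) : (D ^+ k %| m')%Z.
  have [j e] := h k.
  have : (D ^+ k %| m' * n ^+ k)%Z.
    apply/dvdzP; exists j; apply: (@intr_inj rat).
    by rewrite !intrM !rmorphXn /= -e -em -eD exprMn; move: (D%:~R : rat) => E; ring.
  by rewrite Gauss_dvdzl // coprimezE !abszX coprimeXl // coprimeXr.
exists n; apply: D1; apply/eqP; apply: contraNT m'0 => d1.
by apply/eqP; apply: dvdz_exp_eq0 dv; move: d1 D0; clear; lia.
Qed.

Lemma rat_sqrt_int (d m : int) (r : rat) : squarefree d -> d%:~R * r ^+ 2 = m%:~R ->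
  exists n : int, r = n%:~R.
Proof.
move=> sd e; have [n [D [D0 cop eD D1]]] := rat_reduced r.
have : (D ^+ 2 %| d * n ^+ 2)%Z.
  apply/dvdzP; exists m; apply: (@intr_inj rat).
  by rewrite !intrM -e -eD; move: (D%:~R : rat) => E; ring.
rewrite Gauss_dvdzl; last by rewrite coprimezE !abszX coprimeXl // coprimeXr.
move/sd; rewrite qualifE /= => /orP d1; exists n; apply: D1.
by case: d1 => /eqP; move: D0; clear; lia.
Qed.

(** * Imaginary quadratic fields *)

Section Coordinates.
Variables (F : fieldExtType rat) (d : int) (s : F).
Hypotheses (d_neg : d < 0) (s_sqr : s ^+ 2 = d%:~R) (s_gen : <<1; s>>%VS = fullv).

Lemma quad_coords (x : F) : exists a b : rat, x = a%:A + b *: s.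
Proof.
have sp (k : nat) : exists a b : rat, s ^+ k = a%:A + b *: s.
  elim: k => [|k [a [b e]]]; first by exists 1, 0; rewrite scale0r addr0 scale1r.
  exists (b * d%:~R), a; rewrite exprSr e mulrDl -!scalerAl mul1r -expr2 s_sqr.
  by rewrite addrC -scalerA -(rmorph_int (in_alg F)).
have : x \in <<1; s>>%VS by rewrite s_gen memvf.
case/Fadjoin_polyP => p /polyOverP p1 ->.
rewrite horner_coef; elim/big_rec: _ => [|i y _ [a [b ->]]].
  by exists 0, 0; rewrite !scale0r addr0.
have /vlineP[k ->] := p1 i; have [a' [b' ->]] := sp i.
exists (k * a' + a), (k * b' + b).
rewrite -scalerAl mul1r scalerDr !scalerA !scalerDl.
by rewrite addrACA.
Qed.

Lemma rat_sqr_neq (a b : rat) : a ^+ 2 = d%:~R * b ^+ 2 -> a = 0 /\ b = 0.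
Proof.
move=> e; have d0 : (d%:~R : rat) < 0 by rewrite ltrz0.
have := sqr_ge0 a; rewrite e; have := sqr_ge0 b => h1 h2.
have b0 : b ^+ 2 = 0.
  apply/eqP; rewrite eq_le h1 andbT leNgt; apply/negP => b0.
  have : d%:~R * b ^+ 2 < 0 by rewrite nmulr_rlt0.
  by rewrite ltNge h2.
have a0 : a ^+ 2 = 0 by rewrite e b0 mulr0.
by move/eqP: b0; move/eqP: a0; rewrite !sqrf_eq0 => /eqP -> /eqP ->.
Qed.

Lemma quad_coords_inj (a b a' b' : rat) :
  a%:A + b *: s = a'%:A + b' *: s -> a = a' /\ b = b'.
Proof.
move=> e.
have e1 : (a - a')%:A = (b' - b) *: s.
  by apply/eqP; rewrite !scalerBl subr_eq addrAC eq_sym subr_eq e addrC.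
have e2 : ((a - a') ^+ 2)%:A = (d%:~R * (b' - b) ^+ 2)%:A :> F.
  rewrite -[LHS]/(in_alg F _) rmorphXn /= e1 exprZn s_sqr.
  by rewrite -(rmorph_int (in_alg F)) /= scalerA mulrC.
have /rat_sqr_neq[] : (a - a') ^+ 2 = d%:~R * (b' - b) ^+ 2.
  exact: (fmorph_inj (in_alg F)) e2.
by move=> /eqP + /eqP; rewrite !subr_eq0 => /eqP -> /eqP ->.
Qed.

Lemma quadratic_conj : exists c : {rmorphism F -> F}, c s = - s.
Proof.
have H x : {ab : rat * rat | x = ab.1%:A + ab.2 *: s}.
  by apply: cid; have [a [b ->]] := quad_coords x; exists (a, b).
pose c x := let ab := projT1 (H x) in ab.1%:A - ab.2 *: s.
have cE a b : c (a%:A + b *: s) = a%:A - b *: s.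
  rewrite /c; case: (H _) => -[a' b'] /= e.
  by have [-> ->] := quad_coords_inj e.
have cB : {morph c : x y / x - y}.
  move=> x y; have [a [b ->]] := quad_coords x; have [a' [b' ->]] := quad_coords y.
  have -> : a%:A + b *: s - (a'%:A + b' *: s) = (a - a')%:A + (b - b') *: s.
    by rewrite !scalerBl opprD addrACA.
  by rewrite !cE !scalerBl; move: (a%:A) (a'%:A) (b *: s) (b' *: s) => u v w t; ring.
have cM : {morph c : x y / x * y}.
  move=> x y; have [a [b ->]] := quad_coords x; have [a' [b' ->]] := quad_coords y.
  (* Stated for any [u] with the same square as [s], so that it covers both the product and the
     product of the conjugates. *)
  have mulE (u v : F) (hu : u ^+ 2 = s ^+ 2) : (a%:A + b *: u) * (a'%:A + b' *: u) =
     (a * a' + d%:~R * (b * b'))%:A + (a * b' + b * a') *: u.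
    have dE : (d%:~R : F) = d%:~R%:A by rewrite -(rmorph_int (in_alg F)).
    rewrite mulrDl !mulrDr -!scalerAl !mul1r -!scalerAr -!expr2 hu s_sqr dE !mulr1.
    by rewrite !scalerA !scalerDl [X in _ + X]addrC addrACA [d%:~R * _]mulrC -mulrA.
  have := mulE (- s) s; rewrite sqrrN !scalerN => mN.
  by rewrite mulE // !cE mN.
have c1 : c 1 = 1.
  by rewrite -[1 in LHS](addr0) -(scale0r s) -[X in X + _]scale1r cE scale0r subr0 scale1r.
pose cA := GRing.isZmodMorphism.Build _ _ c cB.
pose cMM := GRing.isMonoidMorphism.Build _ _ c (c1, cM).
pose cR : {rmorphism F -> F} := HB.pack c cA cMM.
exists cR; rewrite /= -[s in LHS]scale1r -[X in c X]add0r -(scale0r 1) cE.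
by rewrite scale0r scale1r add0r.
Qed.

End Coordinates.

Section QuadraticIntegers.
Variables (F : fieldExtType rat) (d : int) (s : F) (c : {rmorphism F -> F}).
Hypotheses (d_neg : d < 0) (d_sqf : squarefree d).
Hypotheses (s_sqr : s ^+ 2 = d%:~R) (s_gen : <<1; s>>%VS = fullv) (c_s : c s = - s).

Lemma alg_int (m : int) : (m%:~R : rat)%:A = m%:~R :> F.
Proof. exact: (rmorph_int (in_alg F)). Qed.

Lemma alg_exp_mul (r : rat) (k : nat) (m : int) :
  (r ^+ k * m%:~R)%:A = r%:A ^+ k * m%:~R :> F.
Proof. by rewrite exprZn expr1n -alg_int -scalerAl mul1r scalerA. Qed.

Lemma conj_alg (r : rat) : c r%:A = r%:A.
Proof. by rewrite fmorph_numZ rmorph1. Qed.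

Lemma conj_coords (a b : rat) : c (a%:A + b *: s) = a%:A - b *: s.
Proof. by rewrite rmorphD conj_alg fmorph_numZ /= c_s scalerN. Qed.

Lemma conjK x : c (c x) = x.
Proof.
have [a [b ->]] := quad_coords s_sqr s_gen x.
by rewrite conj_coords -scaleNr conj_coords scaleNr opprK.
Qed.

Lemma trace_rat x : exists t : rat, x + c x = t%:A.
Proof.
have [a [b ->]] := quad_coords s_sqr s_gen x; exists (2 * a).
by rewrite conj_coords mulrDl mul1r scalerDl; move: (a%:A) (b *: s) => u v; ring.
Qed.

Lemma norm_rat x : exists n : rat, [/\ x * c x = n%:A, 0 <= n & (x != 0 -> 0 < n)].
Proof.
have [a [b ->]] := quad_coords s_sqr s_gen x.
have d0 : (d%:~R : rat) < 0 by rewrite ltrz0.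
have n0 : 0 <= a ^+ 2 - d%:~R * b ^+ 2.
  by rewrite addr_ge0 ?sqr_ge0 // -mulNr mulr_ge0 ?sqr_ge0 // oppr_ge0 ltW.
exists (a ^+ 2 - d%:~R * b ^+ 2); split=> // [|x0].
  rewrite conj_coords mulrC -subr_sqr !exprZn expr1n s_sqr -alg_int scalerA.
  by rewrite -scalerBl [d%:~R * _]mulrC.
rewrite lt_neqAle n0 andbT eq_sym; apply: contraNneq x0 => /eqP.
rewrite subr_eq0 => /eqP/(rat_sqr_neq d_neg)[-> ->].
by rewrite !scale0r addr0.
Qed.

Lemma alg_integers (r : rat) : integers F r%:A -> exists m : int, r = m%:~R.
Proof. exact: (@integers_rat _ (in_alg F)). Qed.

Lemma conj_integers x : integers F x -> integers F (c x).
Proof. exact: integers_rmorph. Qed.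

Lemma norm_int x : integers F x -> exists n : int,
  [/\ x * c x = n%:~R, 0 <= n & (x != 0 -> 0 < n)].
Proof.
move=> ix; have [r [e r0 rp]] := norm_rat x.
have : integers F (x * c x) by apply: integersM => //; apply: conj_integers.
rewrite e => /alg_integers[n en]; exists n; move: r0 rp; rewrite en ler0z ltr0z alg_int.
by split.
Qed.

(** For [x = a + b s] the trace [2 a] is an integer, and so is [d (2 b)^2 = (2 a)^2 - 4 N]; as [d]
    is squarefree, [2 b] is an integer too. Keeping the factor 2 treats all residues of [d] modulo 4
    at once. *)
Lemma int_coords x : integers F x -> exists A B N : int,
  [/\ 2 * x = A%:~R + B%:~R * s, x * c x = N%:~R, x + c x = A%:~R &
      A ^+ 2 - d * B ^+ 2 = 4 * N].
Proof.
move=> ix; have [N [eN _ _]] := norm_int ix.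
have [t et] := trace_rat x.
have : integers F (x + c x) by apply: integersD => //; apply: conj_integers.
rewrite et => /alg_integers[A eA].
have [a [b ex]] := quad_coords s_sqr s_gen x.
have e2 : 2 * x = A%:~R + (2 * b) *: s.
  have -> : (2 * b) *: s = b *: s + b *: s by rewrite mulrDl mul1r scalerDl.
  rewrite -alg_int -eA -et ex conj_coords.
  by move: (a%:A) (b *: s) => u v; ring.
have e4 : d%:~R * (2 * b) ^+ 2 = (A ^+ 2 - 4 * N)%:~R.
  apply: (fmorph_inj (in_alg F)) => /=.
  rewrite alg_int -mulr_algl mulr1 -[X in (d%:~R * _) *: X]mulr1.
  have -> : (d%:~R * (2 * b) ^+ 2) *: (1 * 1) = ((2 * b) *: s) ^+ 2 :> F.
    by rewrite exprZn s_sqr -alg_int scalerA mulr1 mulrC.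
  have -> : (2 * b) *: s = 2 * x - A%:~R by rewrite e2 addrC addKr.
  rewrite intrB !intrM -eN -[4%:~R]/(4%:R).
  rewrite (_ : A%:~R = x + c x); last by rewrite et eA alg_int.
  by ring.
have [B eB] := rat_sqrt_int d_sqf e4.
exists A, B, N; split=> //.
- by rewrite e2 eB -mulr_algl alg_int.
- by rewrite eA alg_int.
apply: (@intr_inj rat).
move: e4; rewrite eB !intrB !intrM => e4.
by rewrite e4; ring.
Qed.

(** Complete integral closedness: multiplied by the norm of [n], all powers of the trace and of the
    norm of [x] are integral, so both are integers. It shows that the multipliers of a nonzero ideal
    are integral, without finite generation of ideals. *)
Lemma almost_integral (x n : F) : n != 0 ->
  (forall k, integers F (x ^+ k * n)) -> integers F x.
Proof.
move=> n0 h.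
have in_ : integers F n by rewrite -[n]mul1r -(expr0 x); apply: h.
have [m [em _ /(_ n0) m0]] := norm_int in_.
have mr0 : (m%:~R : rat) != 0 by rewrite intr_eq0 gt_eqF.
have [r [er _ _]] := norm_rat x; have [t et] := trace_rat x.
have [N eN] : exists N : int, r = N%:~R.
  apply: rat_powers_int mr0 _ => k; apply: alg_integers.
  have -> : (r ^+ k * m%:~R)%:A = (x ^+ k * n) * c (x ^+ k * n).
    rewrite alg_exp_mul -er -em.
    by rewrite rmorphM rmorphXn exprMn mulrACA.
  by apply: integersM => //; apply: conj_integers.
have [T eT] : exists T : int, t = T%:~R.
  apply: rat_powers_int mr0 _ => k; apply: alg_integers.
  have -> : (t ^+ k * m%:~R)%:A = (x + c x) ^+ k * (n * c n).
    by rewrite alg_exp_mul -et -em.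
  rewrite exprDn mulr_suml; apply: integers_sum => i _.
  rewrite -mulr_natl -mulrA mulrACA -rmorphXn -rmorphM.
  by apply: integersM; [apply: integers_nat | apply: integersM => //; apply: conj_integers].
apply: (@integers_quadratic _ x T N).
by rewrite -alg_int -eT -et -alg_int -eN -er; ring.
Qed.

End QuadraticIntegers.

(** * Genus theory *)

Lemma odd_involution_fixpoint (n : nat) (f : 'I_n -> 'I_n) :
  odd n -> involutive f -> exists i, f i = i.
Proof.
move=> on ff; have [[i /eqP]|h] := pselect (exists i, f i == i); first by exists i.
have nf i : f i != i by apply/negP => e; apply: h; exists i.
pose A := [pred i : 'I_n | (f i < i)%N]; pose B := [pred i : 'I_n | (i < f i)%N].
have cAB : #|A| = #|B|.
  rewrite -(fintype.card_image (inv_inj ff)); apply: eq_card => i.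
  apply/fintype.imageP/idP => [[j] + ->|]; rewrite !inE ?ff // => hi.
  by exists (f i); rewrite ?inE ?ff.
have : (#|A| + #|B| = n)%N.
  rewrite -[RHS]card_ord -(cardC A); congr addn; apply: eq_card => i.
  rewrite !inE -leqNgt ltn_neqAle; case: eqP => //= e.
  by have /eqP[] := nf i; apply: val_inj.
by rewrite cAB addnn => e; rewrite -e odd_double in on.
Qed.

Section Ideals.
Local Open Scope classical_set_scope.
Variable K : fieldType.
Implicit Types (I J : set K) (m w x y z : K).

Definition ideal_scale x I : set K := [set x * z | z in I].

(** For an ideal [I], its product with the ideal generated by [m] and [w]; with two generators, sums
    of two terms suffice. *)
Definition ideal_mul2 m w I : set K :=
  [set z | exists a b, [/\ I a, I b & z = m * a + w * b]].

Lemma ideal_scaleM x y I : ideal_scale (x * y) I = ideal_scale x (ideal_scale y I).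
Proof.
apply/seteqP; split=> [_ [a Ia <-]|_ [_ [a Ia <-] <-]].
  by exists (y * a); [exists a | rewrite mulrA].
by exists a; rewrite ?mulrA.
Qed.

Lemma ideal_mul2_scale m w x I :
  ideal_mul2 m w (ideal_scale x I) = ideal_scale x (ideal_mul2 m w I).
Proof.
apply/seteqP; split=> z.
  move=> [_ [_ [[a Ia <-] [b Ib <-] ->]]]; exists (m * a + w * b); last by ring.
  by exists a, b.
move=> [_ [a [b [Ia Ib ->]]] <-]; exists (x * a), (x * b).
by split; [exists a | exists b | ring].
Qed.

Lemma ideal_equiv_refl I : ideal_equiv I I.
Proof. by exists 1, 1; split; rewrite ?oner_neq0 //; apply: integers1. Qed.

Lemma ideal_equiv_sym I J : ideal_equiv I J -> ideal_equiv J I.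
Proof. by move=> [x [y [ix iy x0 y0 e]]]; exists y, x; split. Qed.

Lemma ideal_equiv_trans I J J' :
  ideal_equiv I J -> ideal_equiv J J' -> ideal_equiv I J'.
Proof.
move=> [x [y [ix iy x0 y0 e]]] [x' [y' [ix' iy' x'0 y'0 e']]].
exists (x' * x), (y * y'); split; rewrite ?mulf_neq0 //; try exact: integersM.
have e1 : ideal_scale x I = ideal_scale y J := e.
have e2 : ideal_scale x' J = ideal_scale y' J' := e'.
rewrite -[LHS]/(ideal_scale (x' * x) I) -[RHS]/(ideal_scale (y * y') J').
by rewrite ideal_scaleM e1 -ideal_scaleM (mulrC x' y) !ideal_scaleM e2.
Qed.

Lemma ideal_equiv_mul2 m w I J :
  ideal_equiv I J -> ideal_equiv (ideal_mul2 m w I) (ideal_mul2 m w J).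
Proof.
move=> [x [y [ix iy x0 y0 e]]]; exists x, y; split=> //.
have e1 : ideal_scale x I = ideal_scale y J := e.
rewrite -[LHS]/(ideal_scale x (ideal_mul2 m w I)).
by rewrite -[RHS]/(ideal_scale y (ideal_mul2 m w J)) -!ideal_mul2_scale e1.
Qed.

Lemma nonzero_ideal_mul2 m w I : integers K m -> integers K w -> m != 0 ->
  nonzero_ideal I -> nonzero_ideal (ideal_mul2 m w I).
Proof.
move=> im iw m0 [[sI I0 ID IM] [n In n0]]; split; last first.
  by exists (m * n); rewrite ?mulf_neq0 //; exists n, 0; split=> //; ring.
split.
- by move=> _ [a [b [/sI Ia /sI Ib ->]]]; apply: integersD; apply: integersM.
- by exists 0, 0; split=> //; ring.
- move=> _ _ [a [b [Ia Ib ->]]] [a' [b' [Ia' Ib' ->]]].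
  by exists (a + a'), (b + b'); split; [exact: ID | exact: ID | ring].
- move=> e _ ie [a [b [Ia Ib ->]]].
  by exists (e * a), (e * b); split; [exact: IM | exact: IM | ring].
Qed.

(** The square of [(m, w)] is [(m^2, m w, m g) = m (m, w, g)], and the last identity says that [m],
    [w] and [g] generate the unit ideal. *)
Lemma ideal_mul2_twice m w g u v t I : is_ideal I ->
  integers K m -> integers K w -> integers K g ->
  integers K u -> integers K v -> integers K t ->
  w ^+ 2 = m * g -> u * m + v * w + t * g = 1 ->
  ideal_mul2 m w (ideal_mul2 m w I) = ideal_scale m I.
Proof.
move=> [sI I0 ID IM] im iw ig iu iv it ew eu; apply/seteqP; split=> z.
  move=> [_ [_ [[a [b [Ia Ib ->]]] [a' [b' [Ia' Ib' ->]]] ->]]].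
  exists (m * a + w * b + (w * a' + g * b')).
    by apply: (ID); apply: (ID); apply: (IM).
  transitivity (m * (m * a + w * b) + w * m * a' + m * g * b'); first by ring.
  by rewrite -ew; ring.
move=> [a Ia <-]; exists (m * (u * a) + w * (v * a)), (m * 0 + w * (t * a)); split.
- by exists (u * a), (v * a); split=> //; apply: IM.
- by exists 0, (t * a); split=> //; apply: IM.
transitivity (m * a * (u * m + v * w + t * g)); first by rewrite eu mulr1.
transitivity (m * (m * (u * a) + w * (v * a)) + m * g * (t * a)); first by ring.
by rewrite -ew; ring.
Qed.

Lemma ideal_class_eq I J : nonzero_ideal I -> nonzero_ideal J ->
  ideal_class I = ideal_class J <-> ideal_equiv I J.
Proof.
move=> nI nJ; split=> [e|e].
  have : ideal_class J J by split=> //; apply: ideal_equiv_refl.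
  by rewrite -e => -[].
apply/seteqP; split=> H [nH h]; split=> //; last exact: ideal_equiv_trans e h.
exact: ideal_equiv_trans (ideal_equiv_sym e) h.
Qed.

(* Multiplication by the ideal [(m, w)], whose square is the principal ideal
   [(m)], is an involution of the class set, which has odd cardinality. *)
Lemma class_fixpoint (l : nat) m w g u v t : odd l -> has_class_number K l ->
  m != 0 -> integers K m -> integers K w -> integers K g ->
  integers K u -> integers K v -> integers K t ->
  w ^+ 2 = m * g -> u * m + v * w + t * g = 1 ->
  exists I, nonzero_ideal I /\ ideal_equiv (ideal_mul2 m w I) I.
Proof.
move=> ol /card_set_bijP[f [fto finj fsurj]] m0 im iw ig iu iv it ew eu.
have [rep repP] : {rep : 'I_l -> set K &
    forall i, nonzero_ideal (rep i) /\ f (ideal_class (rep i)) = i}.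
  apply: (@boolp.choice _ _ (fun (i : 'I_l) (I : set K) =>
    nonzero_ideal I /\ f (ideal_class I) = i)) => i.
  have [_ [I nI <-] e] := fsurj i (ltn_ord i).
  by exists I.
have idx_lt I : nonzero_ideal I -> (f (ideal_class I) < l)%N.
  by move=> nI; apply: fto; exists I.
have nT I := @nonzero_ideal_mul2 m w I im iw m0.
pose idx i := Ordinal (idx_lt _ (nT _ (proj1 (repP i)))).
have idxP i : ideal_equiv (rep (idx i)) (ideal_mul2 m w (rep i)).
  have [n1 e1] := repP (idx i).
  apply/(ideal_class_eq n1 (nT _ (proj1 (repP i)))).
  by apply: finj; rewrite ?in_setE ?e1 //; [exists (rep (idx i)) |
    exists (ideal_mul2 m w (rep i)) => //; apply: (nT); apply: (proj1 (repP i))].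
have idxK : involutive idx.
  move=> i; apply: val_inj => /=; rewrite -[RHS](proj2 (repP i)); congr f.
  apply/ideal_class_eq; [exact: (nT _ (proj1 (repP _))) | exact: (proj1 (repP i)) |].
  apply: (ideal_equiv_trans (ideal_equiv_mul2 m w (idxP i))).
  rewrite (ideal_mul2_twice (proj1 (proj1 (repP i))) im iw ig iu iv it ew eu).
  exists 1, m; split; rewrite ?oner_neq0 //; first exact: integers1.
  by rewrite -[LHS]/(ideal_scale 1 (ideal_scale m (rep i))) -ideal_scaleM mul1r.
have [i ei] := odd_involution_fixpoint ol idxK.
exists (rep i); split; first exact: (proj1 (repP i)).
by apply: ideal_equiv_sym; have := idxP i; rewrite ei.
Qed.
End Ideals.

Lemma sqr_int_cases (B : int) : B ^+ 2 = 0 \/ B ^+ 2 = 1 \/ B ^+ 2 = 4 \/ 9 <= B ^+ 2.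
Proof.
have [->|[[->|->]|[[->|->]|B3]]] :
    B = 0 \/ (B = 1 \/ B = -1) \/ (B = 2 \/ B = -2) \/ (3 <= B \/ B <= -3) by lia.
all: try by [left | right; left | right; right; left].
by right; right; right; nia.
Qed.

(** Excludes an element of norm 2, in the normalisation of [int_coords]. The congruence is needed to
    avoid [d = -7], where [1 + 7 = 8]. *)
Lemma two_form_neq8 (d A B : int) : d <= -5 -> (d = 2 %[mod 4])%Z \/ (d = 3 %[mod 4])%Z ->
  A ^+ 2 - d * B ^+ 2 <> 8.
Proof.
move=> d5 dk; have hA := sqr_int_cases A; have hB := sqr_int_cases B.
move: (A ^+ 2) (B ^+ 2) hA hB => X Y hX [->|[->|hY]] e; [lia | lia |].
by have : 0 <= (- d - 5) * (Y - 4); [rewrite mulr_ge0 //; lia | lia].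
Qed.

Lemma odd_form_neq4 (r n X Y : int) : 3 <= r -> 3 <= n -> odd `|r|%N -> odd `|n|%N ->
  r * X ^+ 2 + n * Y ^+ 2 <> 4.
Proof.
move=> r3 n3 ro no; have hA := sqr_int_cases X; have hB := sqr_int_cases Y.
move: (X ^+ 2) (Y ^+ 2) hA hB => {}X {}Y hX hY.
have [X0|X1] : X = 0 \/ 1 <= X by lia.
  rewrite X0; case: hY => [->|[->|hY]] e; [lia | lia |].
  by have : 0 <= (n - 3) * (Y - 4); [rewrite mulr_ge0 //; lia | lia].
have : 0 <= (r - 3) * (X - 1) by rewrite mulr_ge0 //; lia.
have : 0 <= n * Y by rewrite mulr_ge0; lia.
have [Y0|Y1] : Y = 0 \/ 1 <= Y by lia.
  rewrite Y0; case: hX => [e|[->|hX]]; [lia | lia |].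
  have : 0 <= (r - 3) * (X - 4); [rewrite mulr_ge0 //; lia | lia].
have : 0 <= (n - 3) * (Y - 1) by rewrite mulr_ge0 //; lia.
lia.
Qed.

Section GenusTheory.
Variables (F : fieldExtType rat) (d : int) (s : F) (c : {rmorphism F -> F}).
Hypotheses (d_neg : d < 0) (d_sqf : squarefree d).
Hypotheses (s_sqr : s ^+ 2 = d%:~R) (s_gen : <<1; s>>%VS = fullv) (c_s : c s = - s).
Variables (l : nat) (l_odd : odd l) (hl : has_class_number F l).

Lemma fieldExt_intr_inj : injective (intr : int -> F).
Proof.
move=> a b /(etrans (alg_int F a)) e; apply: (@intr_inj rat).
by apply: (fmorph_inj (in_alg F)); rewrite /= e alg_int.
Qed.

(** For a class fixed by [(m, w)], say [x (m, w) I = y I], the element [z = x m / y] maps [I] to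
    itself and is therefore integral. Applying [(m, w)] twice gives [x^2 m I = y^2 I], so
    [x^2 m / y^2] is a unit, of norm 1; as [z^2] is [m] times this unit, [z] has norm [m]. *)
Lemma class_norm (m : int) (w g u v t : F) : 0 < m ->
  integers F w -> integers F g -> integers F u -> integers F v -> integers F t ->
  w ^+ 2 = m%:~R * g -> u * m%:~R + v * w + t * g = 1 ->
  exists A B : int, A ^+ 2 - d * B ^+ 2 = 4 * m.
Proof.
move=> m0 iw ig iu iv it ew eu.
have mF0 : m%:~R != 0 :> F by rewrite -[0]/(0%:~R) (inj_eq fieldExt_intr_inj) gt_eqF.
have im := integers_int F m.
have [I [nI [x [y [ix iy x0 y0 e]]]]] :=
  class_fixpoint l_odd hl mF0 im iw ig iu iv it ew eu.
have [[sI I0 ID IM] [n In n0]] := nI.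
have e1 : ideal_scale x (ideal_mul2 m%:~R w I) = ideal_scale y I := e.
have stable z : (forall a, I a -> I (z * a)) -> integers F z.
  move=> hz; apply: (almost_integral d_neg s_sqr s_gen c_s n0) => k.
  apply: sI; elim: k => [|k IH]; first by rewrite mul1r.
  by rewrite exprS -mulrA; apply: hz.
pose z := x * m%:~R / y.
have iz : integers F z.
  apply: stable => a Ia.
  have : ideal_scale x (ideal_mul2 m%:~R w I) (x * (m%:~R * a)).
    by exists (m%:~R * a) => //; exists a, 0; split=> //; rewrite mulr0 addr0.
  rewrite e1 => -[b Ib eb]; have -> : z * a = b => //.
  by rewrite /z mulrAC -(mulrA x) -eb mulrAC divff // mul1r.
have e2 : ideal_scale (x ^+ 2 * m%:~R) I = ideal_scale (y ^+ 2) I.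
  rewrite ideal_scaleM -(ideal_mul2_twice (proj1 nI) im iw ig iu iv it ew eu).
  rewrite expr2 ideal_scaleM -ideal_mul2_scale e1 ideal_mul2_scale.
  by rewrite -ideal_scaleM mulrC ideal_scaleM e1 -ideal_scaleM.
have unit_int a b : b != 0 -> ideal_scale a I = ideal_scale b I -> integers F (a / b).
  move=> b0 eab; apply: stable => i Ii.
  have : ideal_scale a I (a * i) by exists i.
  rewrite eab => -[j Ij ej]; have -> : a / b * i = j => //.
  by rewrite mulrAC -ej mulrAC divff // mul1r.
have x2m : x ^+ 2 * m%:~R != 0 by rewrite mulf_neq0 // expf_neq0.
have y2 : y ^+ 2 != 0 by rewrite expf_neq0.
have i1 := unit_int _ _ y2 e2; have i2 := unit_int _ _ x2m (esym e2).
have [n1 [en1 _ /(_ (mulf_neq0 x2m (invr_neq0 y2))) p1]] :=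
  norm_int d_neg s_sqr s_gen c_s i1.
have [n2 [en2 _ /(_ (mulf_neq0 y2 (invr_neq0 x2m))) p2]] :=
  norm_int d_neg s_sqr s_gen c_s i2.
have n12 : n1 * n2 = 1.
  apply: fieldExt_intr_inj; rewrite intrM -en1 -en2 mulrACA -rmorphM.
  by rewrite mulrA divfK // divff // rmorph1 mulr1.
have n11 : n1 = 1 by clear -p1 p2 n12; nia.
have [A [B [N [_ eN _ eAB]]]] := int_coords d_neg d_sqf s_sqr s_gen c_s iz.
have [N' [eN' N0 _]] := norm_int d_neg s_sqr s_gen c_s iz.
have NN : N = N' by apply: fieldExt_intr_inj; rewrite -eN -eN'.
exists A, B; rewrite eAB; congr (4 * _).
have : N ^+ 2 = m ^+ 2.
  apply: fieldExt_intr_inj; rewrite !rmorphXn /= -eN exprMn -rmorphXn.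
  have -> : z ^+ 2 = (x ^+ 2 * m%:~R / y ^+ 2) * m%:~R.
    by rewrite /z expr_div_n exprMn; move: (m%:~R : F) => M; ring.
  by rewrite rmorphM /= mulrACA en1 n11 rmorph_int mul1r expr2.
by clear -NN N0 m0; subst N'; nia.
Qed.

(** A ramified prime yields an ideal [(m, w)] of square [(m)], hence by [class_norm] an element of
    norm [m]; unless [d] is in the list, some [m] is too small to be a norm. *)
Lemma odd_class_number_cases :
  [\/ d = -1, d = -2 | exists r : nat, [/\ prime r, r = 3 %[mod 4] & d = - r%:Z]].
Proof.
have i0 := integers0 F; have i1 := integers1 F; have ii := integers_int F.
have is_ : integers F s by apply: integers_sqr s_sqr.
have [k [dk|[dk|[dk|dk]]]] : exists k, d = 4 * k \/ d = 4 * k + 1 \/ d = 4 * k + 2 \/ d = 4 * k + 3.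
  by exists (d %/ 4)%Z; lia.
- have : (2 ^+ 2 %| d)%Z by rewrite dk dvdz_mulr.
  by move/d_sqf; rewrite qualifE.
- have dN : d = - `|d|%N%:Z by clear -d_neg; lia.
  have n1 : (1 < `|d|)%N by clear -d_neg dk; lia.
  have rp := pdiv_prime n1; have /dvdnP[n2 en] := pdiv_dvd `|d|.
  move: (pdiv _) rp en => r rp en.
  have [n21|n21] := eqVneq n2 1%N.
    constructor 3; exists r; split=> //; rewrite n21 mul1n in en; last by rewrite -en.
    by rewrite -en; clear -d_neg dk; lia.
  have dE : d = - (n2%:Z * r%:Z) by rewrite dN en PoszM.
  have rn2 : ~~ (r %| n2%:Z)%Z.
    apply/negP => /dvdzP[j ej].
    have : (r%:Z ^+ 2 %| d)%Z by apply/dvdzP; exists (- j); rewrite dE ej; ring.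
    move/d_sqf; rewrite qualifE /=; have := prime_gt1 rp.
    by clear; lia.
  have [u [v uv]] := prime_inv_mod rp rn2.
  have r0 : 0 < r%:Z by have := prime_gt0 rp; clear; lia.
  (* The ideal [(r, s)] for a proper prime factor [r] of [|d|]: here [s ^+ 2 = r * (- n2)], and [r]
     and [n2] are coprime. *)
  have [|||||||A [B eAB]] := @class_norm r s (- n2%:Z)%:~R u%:~R 0 (- v)%:~R r0.
  + by [].
  + by [].
  + by [].
  + by [].
  + by [].
  + by rewrite s_sqr -intrM; congr intr; rewrite dE; ring.
  + rewrite mul0r addr0 -!intrM -intrD -[1]/(1%:~R); congr intr.
    by rewrite -uv; ring.
  have rA : (r %| A)%Z.
    rewrite -dvdz_prime_exp2 //; apply/dvdzP; exists (4 - n2%:Z * B ^+ 2).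
    by rewrite dE in eAB; rewrite mulrBl -eAB; ring.
  case/dvdzP: rA => A' eA.
  have e4 : r%:Z * A' ^+ 2 + n2%:Z * B ^+ 2 = 4.
    have rz : r%:Z != 0 by rewrite gt_eqF.
    by apply: (mulIf rz); rewrite -eAB eA dE; ring.
  have odd_d : odd `|d| by rewrite dk; clear; lia.
  rewrite en oddM in odd_d; case/andP: odd_d => o1 o2.
  have r3 : 3 <= r%:Z by have := prime_gt1 rp; clear -o2; lia.
  have n3 : 3 <= n2%:Z.
    have : n2 != 0%N by apply: contraTneq o1 => ->.
    by clear -o1 n21; lia.
  by have := odd_form_neq4 r3 n3 o2 o1 e4.
- have [->|d2] := eqVneq d (-2); first by constructor 2.
  have [|||||||A [B eAB]] := @class_norm 2 s (2 * k + 1)%:~R (- k)%:~R 0 1 isT.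
  + by [].
  + by [].
  + by [].
  + by [].
  + by [].
  + by rewrite s_sqr -intrM; congr intr; rewrite dk; ring.
  + rewrite mul0r addr0 mul1r -intrM -intrD -[1]/(1%:~R); congr intr; ring.
  have [] := @two_form_neq8 d A B _ _ eAB; [|left]; clear -d2 dk d_neg; lia.
have [->|d1] := eqVneq d (-1); first by constructor 1.
(* The ramified prime above 2 is [(2, 1 + s)]: with [d = 4 k + 3], the square of [1 + s] is twice
   [2 k + 2 + s]. *)
have [|||||||A [B eAB]] := @class_norm 2 (1 + s) ((2 * k + 2)%:~R + s) (k + 1)%:~R 1 (-1) isT.
+ exact: integersD.
+ exact: integersD.
+ by [].
+ by [].
+ exact: integersN.
+ rewrite sqrrD expr1n mul1r s_sqr dk.
  by rewrite !intrD !intrM; ring.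
+ by rewrite !intrD !intrM; ring.
have [] := @two_form_neq8 d A B _ _ eAB; [|right]; clear -d1 dk d_neg; lia.
Qed.

End GenusTheory.

(** * Ramification in the Hilbert class field *)

Section MaximalIdeals.
Local Open Scope classical_set_scope.
Local Open Scope ring_scope.
Variable K : fieldType.
Implicit Types (I J Q : set K).

(** Maximality is expressed as invertibility modulo [Q], the form in which it is used. *)
Definition maximal_ideal Q : Prop :=
  [/\ is_ideal Q, ~ Q 1
    & forall u, integers K u -> ~ Q u -> exists2 t, integers K t & Q (u * t - 1)].

Lemma is_ideal_principal a : integers K a -> is_ideal [set a * x | x in integers K].
Proof.
move=> ia; split.
- by move=> _ [x ix <-]; apply: integersM.
- by exists 0; rewrite ?mulr0 //; apply: integers0.
- by move=> _ _ [x ix <-] [y iy <-]; exists (x + y); rewrite ?mulrDr //; apply: integersD.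
- by move=> e _ ie [x ix <-]; exists (e * x); [apply: integersM | rewrite mulrCA].
Qed.

Lemma exists_maximal_ideal a : integers K a -> (forall x, integers K x -> a * x != 1) ->
  exists2 Q, maximal_ideal Q & Q a.
Proof.
move=> ia na.
pose P A := A = set0 \/ [/\ is_ideal A, ~ A 1 & A a].
have [C CP Ctot|A [PA maxA]] := @Zorn_bigcup K P.
  have [[X [CX [X0 nX0]]]|h] := pselect (exists X, C X /\ exists x, X x); last first.
    by left; apply/seteqP; split=> // x [X CX Xx]; apply: h; exists X; split=> //; exists x.
  right; have good Y y : C Y -> Y y -> [/\ is_ideal Y, ~ Y 1 & Y a].
    by move=> CY Yy; case: (CP _ CY) => // Y0; rewrite Y0 in Yy.
  have [[_ z0 _ _] _ aX] := good _ _ CX nX0; split.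
  - split.
    + by move=> x [Y CY Yx]; have [[sY _ _ _] _ _] := good _ _ CY Yx; apply: sY.
    + by exists X.
    + move=> x y [Y CY Yx] [Z CZ Zy].
      have [[_ _ YD _] _ _] := good _ _ CY Yx; have [[_ _ ZD _] _ _] := good _ _ CZ Zy.
      by case: (Ctot _ _ CY CZ) => sub; [exists Z => //; apply: (ZD) => //; apply: sub
        | exists Y => //; apply: (YD) => //; apply: sub].
    + move=> e x ie [Y CY Yx]; have [[_ _ _ YM] _ _] := good _ _ CY Yx.
      by exists Y => //; apply: YM.
  - by move=> [Y CY Y1]; have [_ + _] := good _ _ CY Y1; apply.
  - by exists X.
case: PA => [A0|[iA nA1 Aa]].
  exfalso; apply: (maxA [set a * x | x in integers K]).
    rewrite A0; split=> // sub; apply: (sub a).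
    by exists 1; rewrite ?mulr1 //; apply: integers1.
  right; split; first exact: is_ideal_principal.
    by case=> x ix /eqP; apply/negP; apply: na.
  by exists 1; rewrite ?mulr1 //; apply: integers1.
exists A => //; split=> // u iu nAu.
have [sA A0 AD AM] := iA.
apply: contrapT => h.
apply: (maxA [set z | exists q t, [/\ A q, integers K t & z = q + u * t]]).
  split=> [q Aq|sub].
    by exists q, 0; split=> //; [apply: integers0 | rewrite mulr0 addr0].
  apply: nAu; apply: sub; exists 0, 1; split=> //; first exact: integers1.
  by rewrite mulr1 add0r.
right; split.
- split.
  + by move=> _ [q [t [/sA iq it ->]]]; apply: integersD => //; apply: integersM.
  + by exists 0, 0; split=> //; [apply: integers0 | rewrite mulr0 addr0].
  + move=> _ _ [q [t [Aq it ->]]] [q' [t' [Aq' it' ->]]].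
    exists (q + q'), (t + t'); split; [exact: AD | exact: integersD | ring].
  + move=> e _ ie [q [t [Aq it ->]]].
    exists (e * q), (e * t); split; [exact: AM | exact: integersM | ring].
- move=> [q [t [Aq it e]]]; apply: h; exists t => //.
  have eq_ : q = 1 - u * t by rewrite e addrK.
  have -> : u * t - 1 = (-1) * q by rewrite eq_; ring.
  by apply: AM => //; apply: integersN; apply: integers1.
- by exists a, 0; split=> //; [apply: integers0 | rewrite mulr0 addr0].
Qed.

Lemma ideal_mulD I J x y :
  ideal_mul I J x -> ideal_mul I J y -> ideal_mul I J (x + y).
Proof.
move=> [n [f [g [If Jg ->]]]] [n' [f' [g' [If' Jg' ->]]]].
exists (n + n')%N.
exists (fun i => match fintype.split i with inl j => f j | inr j => f' j end).
exists (fun i => match fintype.split i with inl j => g j | inr j => g' j end).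
split=> [i|i|]; try by case: fintype.split.
rewrite big_split_ord /=; congr (_ + _); apply: eq_bigr => i _.
  by rewrite -[lshift _ _]/(unsplit (inl i)) unsplitK.
by rewrite -[rshift _ _]/(unsplit (inr i)) unsplitK.
Qed.

Lemma ideal_mul_gen I J x y : I x -> J y -> ideal_mul I J (x * y).
Proof.
by move=> Ix Jy; exists 1%N, (fun=> x), (fun=> y); split=> //; rewrite big_ord1.
Qed.

Lemma ideal_mulM I J e x : (forall y, I y -> I (e * y)) -> ideal_mul I J x ->
  ideal_mul I J (e * x).
Proof.
move=> IM [n [f [g [If Jg ->]]]]; exists n, (fun i => e * f i), g; split=> //.
  by move=> i; apply: IM.
by rewrite mulr_sumr; apply: eq_bigr => i _; rewrite mulrA.
Qed.

Lemma ideal_mul_sub I J Q : Q 0 -> (forall x y, Q x -> Q y -> Q (x + y)) ->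
  (forall x y, I x -> J y -> Q (x * y)) -> ideal_mul I J `<=` Q.
Proof.
move=> Q0 QD IJ x [n [f [g [If Jg ->]]]].
by elim/big_rec: _ => // i y _ Qy; apply: (QD) => //; apply: IJ.
Qed.

Section Maximal.
Variables (Q : set K) (Qmax : maximal_ideal Q).

Let sQ : Q `<=` integers K. Proof. by case: Qmax => -[]. Qed.
Lemma maximal_ideal0 : Q 0. Proof. by case: Qmax => -[]. Qed.
Lemma maximal_idealD x y : Q x -> Q y -> Q (x + y). Proof. by case: Qmax => -[] *; auto. Qed.
Lemma maximal_idealM e x : integers K e -> Q x -> Q (e * x).
Proof. by case: Qmax => -[] *; auto. Qed.
Lemma maximal_idealN x : Q x -> Q (- x).
Proof. by move=> Qx; rewrite -mulN1r; apply: maximal_idealM => //; apply/integersN/integers1. Qed.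
Lemma maximal_idealB x y : Q x -> Q y -> Q (x - y).
Proof. by move=> Qx Qy; apply: maximal_idealD => //; apply: maximal_idealN. Qed.

Lemma maximal_ideal_prime : prime_ideal Q.
Proof.
have [iQ nQ1 Qm] := Qmax; split=> // x y ix iy Qxy.
have [Qx|nQx] := pselect (Q x); [by left | right].
have [t it Qt] := Qm _ ix nQx.
have -> : y = t * (x * y) - y * (x * t - 1) by ring.
by apply: maximal_idealB; apply: maximal_idealM.
Qed.

Lemma maximal_ideal_sqr x : integers K x -> Q (x ^+ 2) -> Q x.
Proof.
have [_ _ h] := maximal_ideal_prime; move=> ix; rewrite expr2 => Qx2.
by case: (h _ _ ix ix Qx2).
Qed.

Local Notation Q2 := (ideal_exp Q 2).

Lemma ideal_sqr0 : Q2 0.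
Proof. by exists 0%N, (fun=> 0), (fun=> 0); split=> [[]|[]|] //; rewrite big_ord0. Qed.

Lemma ideal_sqrD x y : Q2 x -> Q2 y -> Q2 (x + y).
Proof. exact: ideal_mulD. Qed.

Lemma ideal_sqrM e x : integers K e -> Q2 x -> Q2 (e * x).
Proof. by move=> ie; apply: ideal_mulM => y; apply: maximal_idealM. Qed.

Lemma ideal_sqr_gen x y : Q x -> Q y -> Q2 (x * y).
Proof.
move=> Qx Qy; apply: ideal_mul_gen => //; rewrite -[y]mulr1.
by apply: ideal_mul_gen => //; apply: integers1.
Qed.

Lemma ideal_sqrB x y : Q2 x -> Q2 y -> Q2 (x - y).
Proof.
move=> h1 h2; apply: ideal_sqrD => //; rewrite -mulN1r; apply: ideal_sqrM => //.
exact/integersN/integers1.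
Qed.

(** An element outside [Q] is invertible modulo [Q], and the error term is a product of two elements
    of [Q]; this takes the place of localisation. *)
Lemma ideal_sqr_cancel u x : integers K u -> ~ Q u -> Q x -> Q2 (u * x) -> Q2 x.
Proof.
have [_ _ h] := Qmax; move=> iu nQu Qx Qux; have [t it Qt] := h _ iu nQu.
have -> : x = t * (u * x) - (u * t - 1) * x by ring.
by apply: ideal_sqrB; [apply: ideal_sqrM | apply: ideal_sqr_gen].
Qed.

Variables (p : nat) (p_prime : prime p) (Qp : Q p%:R).

Lemma maximal_ideal_int (m : int) : Q m%:~R <-> (p %| m)%Z.
Proof.
split=> [Qm|/dvdzP[k ->]]; last first.
  by rewrite intrM; apply: maximal_idealM => //; apply: integers_int.
apply: contraT => pm; have [u [v uv]] := prime_inv_mod p_prime pm.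
have [_ nQ1 _] := Qmax; exfalso; apply: nQ1.
rewrite -[1]/(1%:~R) -uv intrD !intrM.
by apply: maximal_idealD; apply: maximal_idealM => //; apply: integers_int.
Qed.

Lemma ideal_sqr_int (m : int) : Q2 p%:R -> (p %| m)%Z -> Q2 m%:~R.
Proof.
by move=> h /dvdzP[k ->]; rewrite intrM; apply: ideal_sqrM => //; apply: integers_int.
Qed.

End Maximal.
End MaximalIdeals.

(** For [d = -2] this removes the denominators 2 left by [int_coords]: the ring of integers is
    Z[sqrt -2]. *)
Lemma even_coords (A B N : int) : A ^+ 2 + 2 * B ^+ 2 = 4 * N ->
  exists A' B' : int, A = 2 * A' /\ B = 2 * B'.
Proof.
move=> e.
have [a [ea|ea]] : exists a, A = 2 * a \/ A = 2 * a + 1 by exists (A %/ 2)%Z; lia.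
  have [b [eb|eb]] : exists b, B = 2 * b \/ B = 2 * b + 1 by exists (B %/ 2)%Z; lia.
    by exists a, b.
  suff : 2 * (a ^+ 2 + 2 * b ^+ 2 + 2 * b - N) + 1 = 0 by move: (_ - N) => W; lia.
  by apply: (@mulfI _ (2 : int)) => //; move: e; rewrite ea eb; lra.
suff : 2 * (2 * a ^+ 2 + 2 * a + B ^+ 2 - 2 * N) + 1 = 0 by move: (_ - 2 * N) => W; lia.
by move: e; rewrite ea; lra.
Qed.

(** * Square roots that an unramified extension cannot contain *)

Section Ramification.
Local Open Scope classical_set_scope.
Local Open Scope ring_scope.
Variables (F : fieldExtType rat) (d : int) (s : F) (c : {rmorphism F -> F}).
Hypotheses (d_neg : d < 0) (d_sqf : squarefree d).
Hypotheses (s_sqr : s ^+ 2 = d%:~R) (s_gen : <<1; s>>%VS = fullv) (c_s : c s = - s).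
Variables (L : fieldExtType F) (L_unram : unramified_finite L).

Lemma algL_int (m : int) : (m%:~R : F)%:A = m%:~R :> L.
Proof. exact: (rmorph_int (in_alg L)). Qed.

Lemma exists_prime_over (p : nat) : prime p ->
  exists2 Q : set L, maximal_ideal Q & Q p%:R.
Proof.
move=> pp; apply: exists_maximal_ideal; first exact: integers_nat.
move=> x ix; apply/eqP => e.
pose f : {rmorphism rat -> L} := in_alg L \o in_alg F.
have p0 : (p%:R : rat) != 0 by rewrite pnatr_eq0 -lt0n prime_gt0.
have fx : f (p%:R^-1) = x.
  have pL : (p%:R : L) != 0 by rewrite -(rmorph_nat f) fmorph_eq0.
  by apply: (mulfI pL); rewrite fmorphV rmorph_nat e divff.
have [m em] : exists m : int, (p%:R : rat)^-1 = m%:~R by apply: (@integers_rat _ f); rewrite fx.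
have : (1 : int) = p%:Z * m.
  by apply: (@intr_inj rat); rewrite intrM -em -pmulrn divff.
move=> e1; have : (p %| 1)%Z by apply/dvdzP; exists m; rewrite mulrC.
by rewrite dvdzE /= dvdn1; have := prime_gt1 pp; clear; lia.
Qed.

(** With [P] the trace of [Q] on the integers of [F], the hypothesis puts the extension of [P]
    inside [Q^2], so the ramification index would exceed 1. *)
Lemma ramified_contradiction (Q : set L) (p : nat) : prime p -> maximal_ideal Q -> Q p%:R ->
  (forall x : F, integers F x -> Q x%:A -> ideal_exp Q 2 x%:A) -> False.
Proof.
move=> pp Qm Qp h.
have [iQ nQ1 _] := Qm; have [sQ _ _ _] := iQ.
have p0 : (p%:R : F) != 0.
  by rewrite -(rmorph_nat (in_alg F)) fmorph_eq0 pnatr_eq0 -lt0n prime_gt0.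
pose P : set F := [set x | integers F x /\ Q x%:A].
have ialg x : integers F x -> integers L x%:A by apply: (integers_rmorph (in_alg L)).
have algD x y : (x + y)%:A = x%:A + y%:A :> L by rewrite scalerDl.
have algM x y : (x * y)%:A = x%:A * y%:A :> L by exact: (rmorphM (in_alg L)).
have algp : (p%:R : F)%:A = p%:R :> L by exact: (rmorph_nat (in_alg L)).
have iP : is_ideal P.
  split.
  - by move=> x [].
  - by split; [apply: integers0 | rewrite scale0r; apply: (maximal_ideal0 Qm)].
  - move=> x y [ix Qx] [iy Qy]; split; first exact: integersD.
    by rewrite algD; apply: maximal_idealD.
  - move=> e x ie [ix Qx]; split; first exact: integersM.
    by rewrite algM; apply: maximal_idealM => //; apply: ialg.
have nzP : nonzero_prime P.
  split; split=> //.
  - by exists p%:R => //; split; [apply: integers_nat | rewrite algp].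
  - by move=> [_]; rewrite scale1r.
  - move=> x y ix iy [_]; rewrite algM => Qxy.
    have [_ _ hp] := maximal_ideal_prime Qm.
    by case: (hp _ _ (ialg _ ix) (ialg _ iy) Qxy) => ?; [left | right].
have nzQ : nonzero_prime Q.
  split; last exact: maximal_ideal_prime.
  by split=> //; exists p%:R => //; rewrite -(rmorph_nat (in_alg L)) fmorph_eq0.
have sub1 : @ideal_extend F L P `<=` Q.
  apply: ideal_mul_sub; [exact: maximal_ideal0 | exact: maximal_idealD |].
  by move=> _ y [x [ix Qx] <-] iy; rewrite mulrC; apply: maximal_idealM.
have [_] := L_unram nzP nzQ sub1; apply.
apply: ideal_mul_sub; [exact: ideal_sqr0 | exact: ideal_sqrD |].
by move=> _ y [x [ix Qx] <-] iy; rewrite mulrC; apply: ideal_sqrM => //; apply: h.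
Qed.

(** Away from the discriminant [p] does not ramify in [F], so [p] in [Q^2] must come from
    ramification in [L / F]. Concretely, an integer [x] of [F] lying in [Q] is, up to a factor
    outside [Q], a combination of multiples of [p]. *)
Lemma ramified_coprime_disc (Q : set L) (p : nat) : prime p -> maximal_ideal Q -> Q p%:R ->
  ~~ (p %| d)%Z -> odd p \/ (d = 1 %[mod 4])%Z -> ~ ideal_exp Q 2 p%:R.
Proof.
move=> pp Qm Qp pd pd4 Q2p; apply: (ramified_contradiction pp Qm Qp) => x ix Qx.
have [A [B [N [ex eN etr eAB]]]] := int_coords d_neg d_sqf s_sqr s_gen c_s ix.
have ialg y : integers F y -> integers L y%:A by apply: (integers_rmorph (in_alg L)).
have algD u v : (u + v)%:A = u%:A + v%:A :> L by rewrite scalerDl.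
have algM u v : (u * v)%:A = u%:A * v%:A :> L by exact: (rmorphM (in_alg L)).
have icx : integers F (c x) by apply: conj_integers.
have is_ : integers F s by apply: integers_sqr s_sqr.
have Qint := maximal_ideal_int Qm pp Qp.
have Q2int m := @ideal_sqr_int _ _ Qm p m Q2p.
have hN : Q N%:~R.
  by rewrite -algL_int -eN mulrC algM; apply: maximal_idealM => //; apply: ialg.
(* If the conjugate is outside [Q] it can be cancelled from [x * c x = N], a multiple of [p].
   Otherwise trace and norm are both divisible by [p], and then so are both coordinates. *)
have [Qcx|nQcx] := pselect (Q (c x)%:A); last first.
  apply: (ideal_sqr_cancel Qm (ialg _ icx) nQcx Qx).
  by rewrite -algM mulrC eN algL_int; apply/Q2int/Qint.
have pA : (p %| A)%Z.
  by apply/Qint; rewrite -algL_int -etr algD; apply: maximal_idealD.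
have pB : (p %| B)%Z.
  have : (p %| d * B ^+ 2)%Z.
    have -> : d * B ^+ 2 = A * A - 4 * N by rewrite -eAB; ring.
    by rewrite rpredB ?dvdz_mull //; apply/Qint.
  by rewrite dvdz_prime_mul // (negbTE pd) dvdz_prime_exp2.
have [op|ep] := boolP (odd p).
  apply: (@ideal_sqr_cancel _ _ Qm 2) => //; first exact: (integers_nat _ 2).
    move/(Qint 2); rewrite dvdzE /= dvdn_prime2 // => /eqP p2.
    by rewrite p2 in op.
  have -> : 2 * x%:A = A%:~R + B%:~R * s%:A :> L.
    by rewrite -!algL_int -algM -algD -ex algM; congr (_ * _); exact: esym (algL_int 2).
  apply: ideal_sqrD => //; first exact: Q2int.
  by rewrite mulrC; apply: ideal_sqrM => //; [apply: ialg | apply: Q2int].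
have p2 : p = 2%N by case: (even_prime pp) => // op; rewrite op in ep.
have [op|d4] := pd4; first by rewrite op in ep.
have [k dk] : exists k, d = 4 * k + 1 by exists (d %/ 4)%Z; clear -d4; lia.
rewrite p2 in pA pB hN Q2int Qint Q2p.
have [/dvdzP[A' eA] /dvdzP[B' eB]] := (pA, pB).
have n2 : (2 : F) != 0 by rewrite -(rmorph_nat (in_alg F) 2) fmorph_eq0.
(* For [p = 2] the factor 2 in [2 * x] cannot be cancelled, so [x] is rewritten in the integral
   basis [1, w]. *)
pose w : F := (1 + s) / 2.
have w2 : 2 * w = 1 + s by rewrite mulrC divfK.
have iw : integers F w.
  apply: (@integers_quadratic _ _ 1 (- k)).
  apply: (mulfI (mulf_neq0 n2 n2)).
  transitivity ((2 * w) ^+ 2); first by ring.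
  transitivity (2 * (2 * w) + 4 * k%:~R); last by rewrite mulrNz; ring.
  rewrite w2 sqrrD s_sqr dk intrD intrM; ring.
have exw : x = (A' - B')%:~R + (B' * 2)%:~R * w.
  apply: (mulfI n2); rewrite ex eA eB !intrM !intrB.
  transitivity (2 * A'%:~R + 2 * B'%:~R * s); first by ring.
  transitivity (2 * (A'%:~R - B'%:~R) + 2 * B'%:~R * (2 * w)); last by ring.
  by rewrite w2; ring.
have dAB : (2 %| A' - B')%Z.
  have e4 : A' ^+ 2 - d * B' ^+ 2 = N.
    apply: (@mulfI _ (4 : int)) => //; rewrite -eAB eA eB; ring.
  move: hN => /Qint; rewrite -e4 dk; clear -e4.
  have [a [->|->]] : exists a, A' = 2 * a \/ A' = 2 * a + 1 by exists (A' %/ 2)%Z; lia.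
    have [b [->|->]] : exists b, B' = 2 * b \/ B' = 2 * b + 1 by exists (B' %/ 2)%Z; lia.
      by lia.
    rewrite (_ : _ - _ =
      2 * (2 * a ^+ 2 - 8 * k * b ^+ 2 - 8 * k * b - 2 * k - 2 * b ^+ 2 - 2 * b) - 1); last by ring.
    by move: (_ - 2 * b) => W; lia.
  have [b [->|->]] : exists b, B' = 2 * b \/ B' = 2 * b + 1 by exists (B' %/ 2)%Z; lia.
    rewrite (_ : _ - _ = 2 * (2 * a ^+ 2 + 2 * a - 8 * k * b ^+ 2 - 2 * b ^+ 2) + 1); last by ring.
    by move: (_ - 2 * b ^+ 2) => W; lia.
  by lia.
rewrite exw algD algM !algL_int; apply: ideal_sqrD => //; first exact: Q2int.
rewrite mulrC; apply: ideal_sqrM => //; first exact: ialg.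
by apply: Q2int; rewrite dvdz_mull.
Qed.

(** A square root [y] lies in [Q], so [m] lies in [Q^2], as does [p^2]; their greatest common
    divisor [p] then does too. *)
Lemma no_sqrt_ramified (p : nat) (m : int) (y : L) : prime p -> (p %| m)%Z ->
  ~~ (p%:Z ^+ 2 %| m)%Z -> ~~ (p %| d)%Z -> odd p \/ (d = 1 %[mod 4])%Z ->
  y ^+ 2 <> m%:~R.
Proof.
move=> pp pm p2m pd pd4 ey; have [Q Qm Qp] := exists_prime_over pp.
apply: (ramified_coprime_disc pp Qm Qp pd pd4).
have iy : integers L y by apply: integers_sqr ey.
have Qy : Q y.
  by apply: (maximal_ideal_sqr Qm) => //; rewrite ey; apply/(maximal_ideal_int Qm pp Qp).
have Q2m : ideal_exp Q 2 m%:~R by rewrite -ey expr2; apply: ideal_sqr_gen.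
have Q2p2 : ideal_exp Q 2 (p%:Z ^+ 2)%:~R by rewrite expr2 intrM; apply: ideal_sqr_gen.
case/dvdzP: pm p2m Q2m => m' -> p2m Q2m.
have pm' : ~~ (p %| m')%Z.
  by apply: contraNN p2m => /dvdzP[j ->]; rewrite -mulrA dvdz_mull.
have [u [v uv]] := prime_inv_mod pp pm'.
have -> : p%:R = u%:~R * (p%:Z ^+ 2)%:~R + v%:~R * (m' * p%:Z)%:~R :> L.
  rewrite -!intrM -intrD pmulrn; congr intr.
  by transitivity ((u * p%:Z + v * m') * p%:Z); [rewrite uv mul1r | ring].
by apply: ideal_sqrD => //; apply: ideal_sqrM => //; apply: integers_int.
Qed.

(** The ramification of 2 in Q(i): [(1 + y)^2 = 2 y] puts [1 + y] in [Q], hence 2 in [Q^2]. *)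
Lemma no_sqrtN1_disc_odd (y : L) : (d = 1 %[mod 4])%Z -> y ^+ 2 <> -1.
Proof.
move=> d4 ey; have [Q Qm Qp] := exists_prime_over (isT : prime 2).
have d2 : ~~ (2%N %| d)%Z by clear -d4; lia.
apply: (ramified_coprime_disc (isT : prime 2) Qm Qp d2 (or_intror d4)).
have iy : integers L y by apply: (@integers_sqr _ _ (-1)); rewrite ey mulrNz.
have e2 : (1 + y) ^+ 2 = 2 * y by rewrite sqrrD ey; ring.
have iy1 : integers L (1 + y) by apply: integersD => //; apply: integers1.
have Q1y : Q (1 + y).
  by apply: (maximal_ideal_sqr Qm) => //; rewrite e2 mulrC; apply: maximal_idealM.
have -> : 2%N%:R = (- y) * ((1 + y) * (1 + y)) :> L.
  by rewrite -expr2 e2 mulrCA mulNr -expr2 ey opprK mulr1.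
by apply: ideal_sqrM => //; [apply: integersN | apply: ideal_sqr_gen].
Qed.

(** Here 2 already ramifies in [F], so it must be shown that [s] itself falls into [Q^2]. Together
    [s] and [y] produce the eighth roots of unity, whose field is ramified over Q(sqrt -2). *)
Lemma no_sqrtN1_disc8 (y : L) : d = -2 -> y ^+ 2 <> -1.
Proof.
move=> d2 ey; have [Q Qm Qp] := exists_prime_over (isT : prime 2).
have algD u v : (u + v)%:A = u%:A + v%:A :> L by rewrite scalerDl.
have algM u v : (u * v)%:A = u%:A * v%:A :> L by exact: (rmorphM (in_alg L)).
have iy : integers L y by apply: (@integers_sqr _ _ (-1)); rewrite ey mulrNz.
have es : s%:A ^+ 2 = -2 :> L.
  by rewrite expr2 -algM -expr2 s_sqr d2 algL_int mulrNz.
have is_ : integers L s%:A by apply: (@integers_sqr _ _ (-2)); rewrite es mulrNz.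
pose r := s%:A * y.
have r2 : r ^+ 2 = 2 by rewrite exprMn es ey mulrN1 opprK.
have n2 : (2 : L) != 0 by rewrite -(rmorph_nat (in_alg L \o in_alg F) 2) fmorph_eq0.
have r0 : r != 0 by rewrite -sqrf_eq0 r2.
(* A primitive eighth root of unity. From [(1 + z)^2 = 2 z + z r], with 2 and [(1 + z)^2] in [Q^2],
   the element [r] and its associate [s] lie in [Q^2]. *)
pose z := (1 + y) / r.
have zr : z * r = 1 + y by rewrite divfK.
have z2 : z ^+ 2 = y.
  by rewrite expr_div_n r2 sqrrD ey; apply: (mulIf n2); rewrite divfK //; ring.
have iz : integers L z.
  exists ('X^4 + 1); first by rewrite -[1]opprK -polyCN monicXnsubC.
  rewrite rmorphD /= map_polyXn rmorph1 /root !hornerE.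
  by rewrite -[4%N]/(2 * 2)%N exprM z2 ey addNr.
have ir : integers L r by apply: integersM.
have Qr : Q r by apply: (maximal_ideal_sqr Qm) => //; rewrite r2.
have i1z : integers L (1 + z) by apply: integersD => //; apply: integers1.
have e1 : (1 + z) ^+ 2 = 2 * z + z * r by rewrite zr sqrrD z2; ring.
have Q1z : Q (1 + z).
  apply: (maximal_ideal_sqr Qm) => //; rewrite e1.
  by apply: (maximal_idealD Qm); [rewrite mulrC|]; apply: (maximal_idealM Qm).
have Q22 : ideal_exp Q 2 2 by rewrite -r2 expr2; apply: ideal_sqr_gen.
have Q2zr : ideal_exp Q 2 (z * r).
  have -> : z * r = (1 + z) * (1 + z) - z * 2 by rewrite -expr2 e1; ring.
  by apply: ideal_sqrB => //; [apply: ideal_sqr_gen | apply: ideal_sqrM].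
have Q2s : ideal_exp Q 2 s%:A.
  have -> : s%:A = (- z) * (z * r).
    by rewrite mulrA mulNr -expr2 z2 /r mulNr mulrCA -expr2 ey mulrN1 opprK.
  by apply: ideal_sqrM => //; apply: integersN.
apply: (ramified_contradiction (isT : prime 2) Qm Qp) => x ix Qx.
have [A [B [N [ex eN etr eAB]]]] := int_coords d_neg d_sqf s_sqr s_gen c_s ix.
have [A' [B' [eA eB]]] : exists A' B', A = 2 * A' /\ B = 2 * B'.
  by apply: (@even_coords _ _ N); rewrite -eAB d2; ring.
have n2F : (2 : F) != 0 by rewrite -(rmorph_nat (in_alg F) 2) fmorph_eq0.
have exw : x = A'%:~R + B'%:~R * s.
  by apply: (mulfI n2F); rewrite ex eA eB !intrM; ring.
have iB := integers_int L B'.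
move: Qx; rewrite exw algD algM !algL_int => Qx.
have QA : Q A'%:~R.
  rewrite -[A'%:~R](addrK (B'%:~R * s%:A)); apply: (maximal_idealB Qm) => //.
  apply: (maximal_idealM Qm) => //; apply: (maximal_ideal_sqr Qm) => //.
  by rewrite es; apply: (maximal_idealN Qm).
apply: ideal_sqrD => //; last exact: ideal_sqrM.
by apply: (@ideal_sqr_int _ _ Qm 2) => //; apply/(maximal_ideal_int Qm _ Qp).
Qed.
End Ramification.

(** * The degree of the Hilbert class field *)

Section EvenGaloisGroup.
Import GroupScope.
Local Open Scope ring_scope.

(** In an abelian group of even order the squares form a proper subgroup, because an element of
    order 2 makes squaring non-injective; [M] is a maximal subgroup above it. *)
Lemma abelian_even_maximal (gT : finGroupType) (G : {group gT}) :
  abelian G -> ~~ odd #|G| ->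
  exists M : {group gT}, maximal M G /\ forall x, x \in G -> (x * x)%g \in M.
Proof.
move=> ab ev.
have comm x y : x \in G -> y \in G -> (x * y = y * x)%g.
  by move=> Gx Gy; have /centsP/(_ x Gx y Gy) := ab.
pose K := [set (x * x)%g | x in G].
have gK : group_set K.
  apply/group_setP; split; first by apply/imsetP; exists 1%g; rewrite ?mulg1.
  move=> _ _ /imsetP[x Gx ->] /imsetP[y Gy ->]; apply/imsetP; exists (x * y)%g.
    exact: groupM.
  by rewrite !mulgA; congr (_ * _)%g; rewrite -!mulgA; congr (_ * _)%g; apply: comm.
have sKG : group gK \subset G.
  by apply/fintype.subsetP => _ /imsetP[x Gx ->]; apply: groupM.
have [KG|[M maxM sKM]] := maximal_exists sKG; last first.
  by exists M; split=> // x Gx; apply: (fintype.subsetP sKM); apply: imset_f.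
have d2 : (2 %| #|G|)%N by rewrite dvdn2.
have [x Gx ox] := Cauchy (isT : prime 2) d2.
have /imset_injP inj : #|[set (x * x)%g | x in G]| == #|G| by rewrite -{2}KG.
have x1 : x = 1%g.
  by apply: inj => //; rewrite mulg1 -expg2 -ox expg_order.
by rewrite x1 order1 in ox.
Qed.

(** Take [g] outside [M] and [t] fixed by [M] but not by [g]. As [g^2] is in [M], the difference
    [y = t - g t] is fixed by [M] and negated by [g]. *)
Lemma even_galois_sqrt (F : fieldType) (L : splittingFieldType F) :
  (2 : L) != 0 ->
  galois 1 {:L} -> abelian 'Gal({:L} / 1)%g -> ~~ odd #|'Gal({:L} / 1)%g| ->
  exists (y : L) (a : F), y ^+ 2 = a%:A /\ forall b : F, y != b%:A.
Proof.
move=> n2 gal ab ev.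
have [M [maxM sqM]] := abelian_even_maximal ab ev.
case/maxgroupP: maxM => /properP[sMG [g Gg nMg]] maxM.
have [fixM|/subvPn[t Mt]] := boolP (fixedField M <= fixedSpace g)%VS.
  case/negP: nMg; rewrite -(gal_fixedField M) gal_kHom ?capvSl //.
  apply/kHomP; split=> [a b _ _|a Ka]; first exact: rmorphM.
  by apply/fixedSpaceP; apply: (subvP fixM).
move/fixedSpaceP/eqP => gt.
have fixt h : h \in M -> h t = t by exact: (fixedFieldP (memvf t) Mt).
have galC h a : h \in 'Gal({:L} / 1)%g -> h (g a) = g (h a).
  move=> Gh; rewrite -(galM g h) ?memvf // -(galM h g) ?memvf //.
  by have /centsP/(_ h Gh g Gg) -> := ab.
pose y := t - g t.
have gy : g y = - y.
  rewrite /y rmorphB /= -(galM g g) ?memvf // (fixt _ (sqM _ Gg)).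
  by rewrite opprB.
have My h : h \in M -> h y = y.
  by move=> Mh; rewrite /y rmorphB /= galC ?(fintype.subsetP sMG) // fixt.
(* The stabiliser of [y ^+ 2] contains [M] and [g], so by maximality of [M] it is the whole
   group. *)
pose N := [set h in 'Gal({:L} / 1)%g | h (y ^+ 2) == y ^+ 2].
have gN : group_set N.
  apply/group_setP; split; first by rewrite inE group1 gal_id eqxx.
  move=> h k; rewrite !inE => /andP[Gh /eqP eh] /andP[Gk /eqP ek].
  by rewrite groupM // galM ?memvf // eh ek eqxx.
have NG : N = 'Gal({:L} / 1)%g.
  apply/eqP; rewrite eqEproper; apply/andP; split.
    by apply/fintype.subsetP => h; rewrite inE => /andP[].
  apply/negP => pN; have := maxM (group gN) pN.
  have sMN : M \subset group gN.
    by apply/fintype.subsetP => h Mh; rewrite inE (fintype.subsetP sMG) //= rmorphXn /= My.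
  move/(_ sMN) => eN; case/negP: nMg; rewrite -eN inE Gg /=.
  by rewrite rmorphXn /= gy sqrrN.
have /galois_fixedField fixG := gal.
have : y ^+ 2 \in fixedField 'Gal({:L} / 1)%g.
  apply/fixedFieldP; rewrite ?memvf // => h; rewrite -NG inE.
  by case/andP=> _ /eqP.
rewrite fixG => /vlineP[a ea]; exists y, a; split=> // b; apply/eqP => eb.
have : g y = y by rewrite eb; apply: (fixed_gal (sub1v _) Gg); rewrite memvZ ?mem1v.
rewrite gy => /eqP; rewrite eq_sym -addr_eq0 -mulr2n -mulr_natr mulf_eq0 (negbTE n2) orbF.
by rewrite subr_eq0 eq_sym (negbTE gt).
Qed.

End EvenGaloisGroup.

(** * The conjugate of an extension of [F] *)

Section Twist.
Import VectorInternalTheory.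
Variables (F : fieldType) (c : {rmorphism F -> F}) (cK : involutive c).
Variable L : splittingFieldType F.

(* The field [L], seen as an extension of [F] through the automorphism [c]. *)
Definition twist of involutive c : Type := L.
Local Notation Lc := (twist cK).

HB.instance Definition _ := GRing.Field.on Lc.

Definition twist_scale (a : F) (x : Lc) : Lc := (c a *: (x : L))%R.

Fact twist_scaleA a b x : twist_scale a (twist_scale b x) = twist_scale (a * b) x.
Proof. by rewrite /twist_scale scalerA rmorphM. Qed.
Fact twist_scale1 x : twist_scale 1 x = x.
Proof. by rewrite /twist_scale rmorph1 scale1r. Qed.
Fact twist_scaleDr a x y : twist_scale a (x + y) = twist_scale a x + twist_scale a y.
Proof. exact: scalerDr. Qed.
Fact twist_scaleDl x a b : twist_scale (a + b) x = twist_scale a x + twist_scale b x.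
Proof. by rewrite /twist_scale rmorphD scalerDl. Qed.

HB.instance Definition _ := GRing.Zmodule_isLmodule.Build F Lc
  twist_scaleA twist_scale1 twist_scaleDr twist_scaleDl.

Fact twist_scaleAl a (x y : Lc) : a *: (x * y) = (a *: x) * y.
Proof. exact: (scalerAl (c a) (x : L) (y : L)). Qed.
HB.instance Definition _ := GRing.Lmodule_isLalgebra.Build F Lc twist_scaleAl.

Fact twist_scaleAr a (x y : Lc) : a *: (x * y) = x * (a *: y).
Proof. exact: (scalerAr (c a) (x : L) (y : L)). Qed.
HB.instance Definition _ := GRing.Lalgebra_isAlgebra.Build F Lc twist_scaleAr.

Fact twist_vect_axiom : Vector.axiom (dim L) Lc.
Proof.
(* Coordinates of [L], conjugated entrywise: the involution undoes the twist of the scalars and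
   restores linearity. *)
pose f (x : Lc) : 'rV[F]_(dim L) := map_mx c (VectorInternalTheory.v2r (x : L)).
exists f.
  have lin a (u v : L) : map_mx c (VectorInternalTheory.v2r (c a *: u + v)) =
      a *: map_mx c (VectorInternalTheory.v2r u) + map_mx c (VectorInternalTheory.v2r v).
    by rewrite linearP /= map_mxD map_mxZ /= cK.
  by move=> a x y; apply: lin.
have cc n (r : 'rV[F]_n) : map_mx c (map_mx c r) = r.
  by apply/matrixP => i j; rewrite !mxE cK.
by exists (fun r => r2v (map_mx c r) : Lc) => [x|r]; rewrite /f ?r2vK cc ?v2rK.
Qed.
HB.instance Definition _ := Lmodule_hasFinDim.Build F Lc twist_vect_axiom.
Definition twist_fieldExt : fieldExtType F := Lc.

Lemma twist_scaleE a (x : L) : a *: (x : twist_fieldExt) = c a *: x.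
Proof. by []. Qed.

Lemma span_twist (X : seq L) (x : L) :
  (x \in <<X>>%VS) = (x \in @span F twist_fieldExt X).
Proof.
elim: X x => [|a X IH] x.
  by rewrite span_nil memv0 (@span_nil F twist_fieldExt); apply: esym (@memv0 F twist_fieldExt x).
rewrite span_cons (@span_cons F twist_fieldExt a X).
apply/memv_addP/(@memv_addP F twist_fieldExt) => -[_ /vlineP[k ->] [y Xy ->]].
  exists (c k *: (a : twist_fieldExt)); first by apply/vlineP; exists (c k).
  by exists y; rewrite -?IH // twist_scaleE cK.
exists (c k *: a); first by apply/vlineP; exists (c k).
by exists y; rewrite ?IH.
Qed.

Lemma one_twist (x : L) :
  (x \in (1%VS : {vspace L})) = (x \in (1%VS : {vspace twist_fieldExt})).
Proof.
apply/vlineP/(@vlineP F twist_fieldExt) => -[k ->]; exists (c k); last by [].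
exact: (esym (congr1 (fun a => a *: (1 : L)) (cK k))).
Qed.

(** The same polynomial and roots serve. A subfield of the twist has the same elements as a subfield
    of [L], so if it contains the roots it is everything. *)
Fact twist_splitting_axiom : splitting_field_axiom twist_fieldExt.
Proof.
have [p p1 [rs prs gen]] := @splittingFieldP_subproof F L.
exists p; first by apply/polyOverP => i; rewrite -one_twist; apply: (polyOverP p1).
exists rs => //; apply/eqP; rewrite eqEsubv subvf; apply/subvP => x _ /=.
pose E' := <<1%VS & (rs : seq twist_fieldExt)>>%AS.
pose E := <<(vbasis E' : seq L)>>%VS.
have EE' y : (y \in E) = (y \in E') by rewrite span_twist (span_basis (vbasisP E')).
have aE : is_aspace E.
  rewrite /is_aspace has_algid1; last by rewrite EE'; exact: (@mem1v F twist_fieldExt E').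
  by apply/prodvP => u v; rewrite !EE'; apply: (@memvM F twist_fieldExt E').
have : (<<1%VS & rs>> <= ASpace aE)%VS.
  apply/Fadjoin_seqP; split; first by rewrite sub1v.
  by move=> y rsy; rewrite EE'; apply: seqv_sub_adjoin.
by rewrite gen => /subvP/(_ (x : L) (@memvf F L x)); rewrite EE'.
Qed.

HB.instance Definition _ := FieldExt_isSplittingField.Build F Lc twist_splitting_axiom.
Definition twist_splittingField : splittingFieldType F := Lc.

End Twist.

Lemma galois_rat_ext (F : fieldExtType rat) (L : splittingFieldType F) :
  galois 1%VS {:L}.
Proof.
apply/and3P; split; [exact: sub1v | | exact: normalFieldf].
apply/separableP => x _; apply: pcharf0_separable => p.
by rewrite pchar_lalg pchar_lalg pchar_num.
Qed.

Section Conjugate.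
Local Open Scope classical_set_scope.
Local Open Scope ring_scope.
Variables (F : fieldExtType rat) (d : int) (s : F) (c : {rmorphism F -> F}).
Hypotheses (d_neg : d < 0) (s_sqr : s ^+ 2 = d%:~R) (cK : involutive c).
Variable L : splittingFieldType F.
Local Notation Lc := (twist_splittingField cK L).

Lemma gal_untwist (x : gal_of {:Lc}) :
  exists2 y : gal_of {:L}, y \in 'Gal({:L} / 1)%g & forall a : L, y a = x a.
Proof.
pose f (a : L) : L := x a.
have fB : zmod_morphism f by move=> a b; apply: (rmorphB x).
have fM a b : f (a * b) = f a * f b by apply: (rmorphM x).
have f1 : f 1 = 1 by apply: (rmorph1 x).
have fZ : scalable f.
  move=> k a; rewrite /f; have -> : k *: a = c k *: (a : Lc) :> L.
    exact: esym (congr1 (fun b => b *: a) (cK k)).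
  have -> : x (c k *: (a : Lc)) = c k *: x a by apply: linearZ.
  exact: (congr1 (fun b => b *: (x a : L)) (cK k)).
pose fA := GRing.isZmodMorphism.Build L L f fB.
pose fS := GRing.isScalable.Build F L L *:%R f fZ.
pose fL : {linear L -> L} := HB.pack f fA fS.
have kf : kHom 1 {:L} (linfun fL).
  apply/kHomP; split=> [a b _ _|a]; rewrite !lfunE /=; first exact: fM.
  by case/vlineP => k ->; rewrite fZ f1.
have [|y Gy ey] := kHom_to_gal _ (normalFieldf 1) kf; first by rewrite sub1v subvv.
by exists y => // a; rewrite -ey ?memvf // lfunE.
Qed.

Lemma twist_abelian : abelian 'Gal({:L} / 1)%g -> abelian 'Gal({:Lc} / 1)%g.
Proof.
move=> ab; apply/centsP => x _ y _; apply/eqP/gal_eqP => a _.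
have [x' Gx ex] := gal_untwist x; have [y' Gy ey] := gal_untwist y.
rewrite !galM ?memvf //.
have e1 : y (x a) = y' (x' (a : L)) :> L.
  exact: etrans (esym (ey _)) (congr1 y' (esym (ex _))).
have e2 : x (y a) = x' (y' (a : L)) :> L.
  exact: etrans (esym (ex _)) (congr1 x' (esym (ey _))).
apply: etrans e1 _; apply: etrans _ (esym e2).
rewrite -(galM x' y') ?memvf // -(galM y' x') ?memvf //.
by have /centsP/(_ x' Gx y' Gy) -> := ab.
Qed.

Lemma conj_nonzero_prime (P : set F) : nonzero_prime P -> nonzero_prime [set x | P (c x)].
Proof.
move=> [[[sP P0 PD PM] [n Pn n0]] [_ nP1 Pp]].
have iP : is_ideal [set x | P (c x)].
  split=> /=.
  - by move=> x /sP /(integers_rmorph c); rewrite cK.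
  - by rewrite rmorph0.
  - by move=> x y Px Py; rewrite rmorphD; apply: PD.
  - by move=> e x /(integers_rmorph c) ie Px; rewrite rmorphM; apply: PM.
split; split=> //=.
- by exists (c n); rewrite /= ?cK // fmorph_eq0.
- by rewrite rmorph1.
by move=> x y /(integers_rmorph c) ix /(integers_rmorph c) iy; rewrite rmorphM; apply: Pp.
Qed.

Lemma ideal_extend_twist (P : set F) :
  @ideal_extend F Lc P = @ideal_extend F L [set x | P (c x)] :> set L.
Proof.
rewrite /ideal_extend; congr (ideal_mul _ _).
apply/seteqP; split=> _ [x Px <-].
  by exists (c x) => //=; rewrite cK.
exists (c x) => //; exact: (congr1 (fun b => b *: (1 : L)) (cK x)).
Qed.

Lemma twist_unramified_finite : unramified_finite L -> unramified_finite Lc.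
Proof.
move=> un P Q nP nQ; rewrite ideal_extend_twist => sub.
have [h1 h2] := un _ (Q : set L) (conj_nonzero_prime nP) nQ sub.
by split; rewrite ideal_extend_twist.
Qed.

(** An embedding that is real on [F] would send [s] to a real number of negative square. *)
Lemma imaginary_unramified_infinite (K : fieldExtType F) : unramified_infinite K.
Proof.
move=> sigma real_; have := real_exprn_even_ge0 (real_ s) (isT : ~~ odd 2).
rewrite -rmorphXn /= exprZn expr1n s_sqr.
have -> : (d%:~R : F)%:A = d%:~R :> K by exact: (rmorph_int (in_alg K)).
by rewrite rmorph_int ler0z leNgt d_neg.
Qed.

Lemma twist_unramified_abelian : unramified_abelian L -> unramified_abelian Lc.
Proof.
move=> [_ ab un _]; split.
- exact: galois_rat_ext.
- exact: twist_abelian.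
- exact: twist_unramified_finite.
- exact: imaginary_unramified_infinite.
Qed.

(** Maximality of [L] applied to its own conjugate: an [F]-embedding of the twist into [L] is a ring
    morphism of [L] that extends [c]. *)
Lemma conj_lift : is_hilbert_class_field L ->
  exists t : {rmorphism L -> L}, forall a : F, t a%:A = (c a)%:A.
Proof.
move=> [ua /(_ _ (twist_unramified_abelian ua))[f]].
pose g (a : L) : L := f a.
have gB : zmod_morphism g by move=> a b; apply: (raddfB f).
have gM : monoid_morphism g by split=> [|a b]; [apply: (rmorph1 f) | apply: (rmorphM f)].
pose gA := GRing.isZmodMorphism.Build L L g gB.
pose gMM := GRing.isMonoidMorphism.Build L L g gM.
pose gR : {rmorphism L -> L} := HB.pack g gA gMM.
exists gR => a; rewrite /= /g.
have -> : a%:A = c a *: (1 : Lc) :> L by exact: esym (congr1 (fun b => b *: (1 : L)) (cK a)).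
have -> : f (c a *: (1 : Lc)) = c a *: f 1 by apply: linearZ.
by rewrite rmorph1.
Qed.
End Conjugate.

(** * Square roots of rational integers in [L] *)

Section OddDegree.
Variables (F : fieldExtType rat) (d : int) (s : F) (c : {rmorphism F -> F}).
Hypotheses (d_neg : d < 0) (d_sqf : squarefree d).
Hypotheses (s_sqr : s ^+ 2 = d%:~R) (s_gen : <<1; s>>%VS = fullv) (c_s : c s = - s).
Variable L : splittingFieldType F.

Definition new_sqrt (m : int) : Prop :=
  (exists z : L, z ^+ 2 = m%:~R) /\ (forall b : F, b ^+ 2 != m%:~R).

Lemma new_sqrt_rat (r : rat) (z : L) : z ^+ 2 = (r%:A : F)%:A ->
  (forall b : F, b ^+ 2 != r%:A) -> exists m, new_sqrt m.
Proof.
move=> ez nb; have [n [D [D0 _ eD _]]] := rat_reduced r.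
have eF : r%:A * D%:~R = n%:~R :> F.
  by rewrite -(alg_int F n) -(alg_int F D) -eD -scalerAl mul1r scalerA.
have em : (n * D)%:~R = r%:A * (D%:~R : F) ^+ 2 by rewrite intrM -eF -mulrA -expr2.
have D0F : (D%:~R : F) != 0.
  by rewrite -[0]/(0%:~R) (inj_eq (@fieldExt_intr_inj F)) gt_eqF.
exists (n * D); split.
  have algM (u v : F) : (u * v)%:A = u%:A * v%:A :> L by exact: (rmorphM (in_alg L)).
  exists (z * (D%:~R : F)%:A).
  by rewrite exprMn ez -(algL_int L) em algM [D%:~R ^+ 2]expr2 algM -expr2.
move=> b; apply: contra_neq (nb (b / D%:~R)) => eb.
by rewrite expr_div_n eb em mulfK // expf_neq0.
Qed.

Lemma exists_new_sqrt (y : L) (a : F) (t : {rmorphism L -> L}) :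
  (forall x : F, t x%:A = (c x)%:A) -> y ^+ 2 = a%:A -> (forall b : F, y != b%:A) ->
  exists m, new_sqrt m.
Proof.
move=> ct ey ny.
have algM (u v : F) : (u * v)%:A = u%:A * v%:A :> L by exact: (rmorphM (in_alg L)).
have na b : b ^+ 2 != a.
  apply/eqP => eb; have : y ^+ 2 == b%:A ^+ 2 by rewrite ey -eb [b ^+ 2]expr2 algM expr2.
  rewrite eqf_sqr (negbTE (ny b)) /= => /eqP e.
  by have := ny (- b); rewrite scaleNr e eqxx.
have a0 : a != 0 by apply: contraNneq (na 0) => ->; rewrite expr0n.
have y0 : y != 0 by apply: contraNneq (ny 0) => ->; rewrite scale0r.
have [n [en _ /(_ a0) n0]] := norm_rat d_neg s_sqr s_gen c_s a.
have [[b eb]|nb] := pselect (exists b : F, b ^+ 2 = n%:A); last first.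
  apply: (@new_sqrt_rat n (y * t y)); last by move=> b; apply/eqP => eb; apply: nb; exists b.
  by rewrite exprMn -rmorphXn ey ct -algM en.
(* The square of [b] is rational, so one coordinate of [b] vanishes; a pure multiple of [s] would
   make [n] at most 0. *)
have [u eu] : exists u : rat, b = u%:A.
  have [u [v ev]] := quad_coords s_sqr s_gen b.
  have e2 : (u ^+ 2 + d%:~R * v ^+ 2)%:A + (2 * u * v) *: s = n%:A + 0 *: s.
    have algF (f g : rat) : (f * g)%:A = f%:A * g%:A :> F by exact: (rmorphM (in_alg F)).
    have algFD (f g : rat) : (f + g)%:A = f%:A + g%:A :> F by rewrite scalerDl.
    rewrite scale0r addr0 -eb ev -!(mulr_algl _ s) algFD !expr2 !algF alg_int -s_sqr.
    have -> : (2 : rat)%:A = 2 :> F by exact: (rmorph_nat (in_alg F) 2).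
    by move: (u%:A : F) (v%:A : F) => U V; ring.
  have [e3 /eqP] := quad_coords_inj d_neg s_sqr e2.
  rewrite !mulf_eq0 /= => /orP[/eqP u0|/eqP v0]; last first.
    by exists u; rewrite ev v0 scale0r addr0.
  have : n <= 0.
    by rewrite -e3 u0 expr0n add0r nmulr_rle0 ?sqr_ge0 // ltrz0.
  by rewrite leNgt n0.
have [tr etr] := trace_rat s_sqr s_gen c_s a.
(* Here [b^2] is replaced by [a * c a]. Hence [a] and [tr + 2 u] differ by a square factor, unless
   [tr + 2 u = 0], in which case [a = - b] is rational. *)
have key : (tr + 2 * u)%:A * a = (a + b) ^+ 2.
  rewrite scalerDl -etr -scalerA -eu.
  have -> : 2 *: b = b + b by rewrite scalerDl scale1r.
  by transitivity (a ^+ 2 + a * c a + 2 * a * b); [ring | rewrite en -eb; ring].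
have [t0|t0] := eqVneq ((tr + 2 * u)%:A : F) 0.
  move/esym/eqP: key; rewrite t0 mul0r sqrf_eq0 addr_eq0 => /eqP ea.
  apply: (@new_sqrt_rat (- u) y); rewrite scaleNr -eu -ea //.
apply: (@new_sqrt_rat (tr + 2 * u) ((a + b)%:A / y)).
  have y20 : a%:A != 0 :> L by rewrite -[a%:A]/(in_alg L a) fmorph_eq0.
  by rewrite expr_div_n ey [_%:A ^+ 2]expr2 -algM -expr2 -key algM mulfK.
move=> e; apply: contra_neq (na ((a + b) / e)) => ee.
by rewrite expr_div_n -key ee mulrC mulKf.
Qed.

Lemma new_sqrt_div (k m : int) : k != 0 -> new_sqrt (k ^+ 2 * m) -> new_sqrt m.
Proof.
move=> k0 [[z ez] nb].
have kF : (k%:~R : F) != 0.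
  by rewrite -[0]/(0%:~R) (inj_eq (@fieldExt_intr_inj F)).
have kL : (k%:~R : L) != 0 by rewrite -(rmorph_int (in_alg L)) fmorph_eq0.
split.
  exists (z / k%:~R); rewrite expr_div_n ez intrM expr2 intrM -expr2.
  by rewrite mulrC mulKf // expf_neq0.
move=> b; apply: contra_neq (nb (k%:~R * b)) => eb.
by rewrite exprMn eb intrM [k ^+ 2]expr2 intrM -expr2.
Qed.

Lemma new_sqrt_disc (m : int) : new_sqrt (d * m) -> new_sqrt m.
Proof.
move=> [[z ez] nb]; apply: (@new_sqrt_div d); first by rewrite lt_eqF.
split.
  exists (z * s%:A); rewrite exprMn ez exprZn expr1n s_sqr.
  by rewrite (algL_int L) -intrM; congr intr; ring.
move=> b; apply: contra_neq (nb (b / s)) => eb.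
have d0 : (d%:~R : F) != 0 by rewrite -[0]/(0%:~R) (inj_eq (@fieldExt_intr_inj F)) lt_eqF.
rewrite expr_div_n eb s_sqr; apply: (mulIf d0); rewrite divfK // -intrM.
by congr intr; ring.
Qed.

Hypothesis d_cases : d = -2 \/ exists r : nat, [/\ prime r, r = 3 %[mod 4] & d = - r%:Z].

Lemma disc_prime_dvd (p : nat) : prime p -> (p %| d)%Z -> `|d|%N = p.
Proof.
move=> pp; case: d_cases => [->|[r [rp _ ->]]].
  by rewrite dvdzE /= dvdn_prime2 // => /eqP ->.
by rewrite dvdzE abszN /= dvdn_prime2 // => /eqP ->.
Qed.

(** Square factors and the factor [d], a square in [F], are stripped from [m]. What remains is 1,
    -1, or has a prime that divides it exactly once and is prime to [d], where the square root would
    ramify. *)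
Lemma no_new_sqrt (m : int) : unramified_finite L -> ~ new_sqrt m.
Proof.
move=> un; have [n] := ubnP `|m|%N; elim: n m => // n IH m hn nm.
have [[z ez] nb] := nm.
have m0 : m != 0 by apply: contraNneq (nb 0) => ->; rewrite expr0n.
have d2 : (1 < `|d|)%N.
  by case: d_cases => [->|[r [rp _ ->]]] //; rewrite abszN prime_gt1.
have [m1|m1] := leqP `|m| 1.
  have [e|e] : m = 1 \/ m = -1 by clear -m0 m1; lia.
    by have := nb 1; rewrite e expr1n eqxx.
  rewrite e mulrNz in ez.
  case: d_cases => [e2|[r [rp r4 er]]].
    exact: (no_sqrtN1_disc8 d_neg d_sqf s_sqr s_gen c_s un e2 ez).
  apply: (no_sqrtN1_disc_odd d_neg d_sqf s_sqr s_gen c_s un _ ez).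
  by rewrite er; clear -r4; lia.
have pp := pdiv_prime m1; have pm : (pdiv `|m| %| m)%Z by rewrite dvdzE pdiv_dvd.
move: (pdiv _) pp pm => p pp pm.
have [/dvdzP[m' em]|np2] := boolP (p%:Z ^+ 2 %| m)%Z.
  have p0 : p%:Z != 0 by have := prime_gt0 pp; clear; lia.
  apply: (IH m'); last by apply: (new_sqrt_div p0); rewrite mulrC -em.
  have : (`|m'| * p ^ 2 = `|m|)%N by rewrite em abszM abszX.
  have m'0 : (0 < `|m'|)%N by rewrite absz_gt0; apply: contraNneq m0 => e; rewrite em e mul0r.
  by have := prime_gt1 pp; clear -hn m'0; nia.
have [pd|pd] := boolP (p %| d)%Z.
  have ed := disc_prime_dvd pp pd.
  have /dvdzP[m' em] : (d %| m)%Z by rewrite dvdzE ed; move: pm; rewrite dvdzE.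
  apply: (IH m'); last by apply: new_sqrt_disc; rewrite mulrC -em.
  have : (`|m'| * `|d| = `|m|)%N by rewrite em abszM.
  have m'0 : (0 < `|m'|)%N by rewrite absz_gt0; apply: contraNneq m0 => e; rewrite em e mul0r.
  by clear -hn m'0 d2; nia.
apply: (no_sqrt_ramified d_neg d_sqf s_sqr s_gen c_s un pp pm np2 pd _ ez).
have [|/negP no] := boolP (odd p); first by left.
have p2 : p = 2%N by case: (even_prime pp).
right; case: d_cases => [e2|[r [rp r4 er]]].
  by rewrite e2 p2 in pd.
by rewrite er; clear -r4; lia.
Qed.

Lemma hilbert_class_field_odd : is_hilbert_class_field L ->
  odd #|'Gal({:L} / 1)%g|.
Proof.
move=> hL; have [[gal ab un _] _] := hL.
apply: contraT => ev.
have n2 : (2 : L) != 0.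
  by rewrite -(rmorph_nat (in_alg L \o in_alg F) 2) fmorph_eq0.
have [y [a [ey ny]]] := even_galois_sqrt n2 gal ab ev.
have cK : involutive c by move=> x; apply: (conjK s_sqr s_gen c_s).
have [t ct] := conj_lift d_neg s_sqr cK hL.
have [m nm] := exists_new_sqrt ct ey ny.
by case: (no_new_sqrt un nm).
Qed.
End OddDegree.

(** * Norms and quaternion algebras *)

Definition is_norm (K : fieldType) (a b : K) : Prop :=
  exists x y : K, b = x ^+ 2 - a * y ^+ 2.

Section Norms.
Variables (K : fieldType) (a : K).

Lemma is_normM b b' : is_norm a b -> is_norm a b' -> is_norm a (b * b').
Proof.
move=> [x [y ->]] [x' [y' ->]].
by exists (x * x' + a * y * y'), (x * y' + y * x'); ring.
Qed.


Lemma is_norm_ternary b x y z : z != 0 -> x ^+ 2 = a * y ^+ 2 + b * z ^+ 2 -> is_norm a b.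
Proof.
move=> z0 e; exists (x / z), (y / z); rewrite !expr_div_n e.
by rewrite mulrDl mulfK ?expf_neq0 // -mulrA addrAC subrr add0r.
Qed.

(** If [b = x^2 - a y^2], then [x + y i + j] and [x - y i - j] are zero divisors. Conversely, a
    nonzero element whose reduced norm [N] vanishes makes [b] a quotient of norms from K(sqrt a), or
    makes [a] a square, and then every element is a norm. *)
Lemma norm_quaternion_division b : (2 : K) != 0 -> a != 0 ->
  division_algebra (quaternion a b) <-> ~ is_norm a b.
Proof.
move=> n2 a0; split=> [div [x [y e]]|nn [x0 x1 x2 x3] xn0].
  pose z : quaternion a b := Quat a b x y 1 0.
  pose z' : quaternion a b := Quat a b x (- y) (- 1) 0.
  have zz : z * z' = 0 by congr Quat; rewrite /= ?e; ring.
  have z0 : z != 0 by apply/eqP => -[_ _ /eqP]; rewrite oner_eq0.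
  have z'0 : z' <> 0 by move=> [_ _ /eqP]; rewrite oppr_eq0 oner_eq0.
  have [u [_ uz]] := div z z0.
  by apply: z'0; rewrite -[z']mul1r -uz -mulrA zz mulr0.
pose N := x0 ^+ 2 - a * x1 ^+ 2 - b * x2 ^+ 2 + a * b * x3 ^+ 2.
have [N0|N0] := eqVneq N 0; last first.
  exists (Quat a b (x0 / N) (- x1 / N) (- x2 / N) (- x3 / N)).
  have NN : N / N = 1 by rewrite divff.
  by split; congr Quat; rewrite /=; first [ring | rewrite -NN /N; ring].
exfalso; apply: nn.
pose D := x2 ^+ 2 - a * x3 ^+ 2.
have eD : x0 ^+ 2 - a * x1 ^+ 2 = b * D.
  by apply/eqP; rewrite -subr_eq0; apply/eqP; rewrite -[RHS]N0 /N /D; ring.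
have [D0|D0] := eqVneq D 0; last first.
  exists ((x0 * x2 - a * x1 * x3) / D), ((x1 * x2 - x0 * x3) / D).
  rewrite !expr_div_n mulrA -mulrBl.
  have -> : (x0 * x2 - a * x1 * x3) ^+ 2 - a * (x1 * x2 - x0 * x3) ^+ 2 =
    (x0 ^+ 2 - a * x1 ^+ 2) * D by rewrite /D; ring.
  by rewrite eD -mulrA -expr2 mulfK // expf_neq0.
suff [e e0 ea] : exists2 e : K, e != 0 & a = e ^+ 2.
  exists ((b + 1) / 2), ((b - 1) / (2 * e)).
  by rewrite ea; field; rewrite n2 e0.
have sq (u v : K) : u ^+ 2 - a * v ^+ 2 = 0 -> v != 0 -> exists2 e : K, e != 0 & a = e ^+ 2.
  move/eqP; rewrite subr_eq0 => /eqP e v0.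
  have ea : a = (u / v) ^+ 2 by rewrite expr_div_n e mulfK // expf_neq0.
  by exists (u / v) => //; apply: contraNneq a0 => h; rewrite ea h expr0n.
rewrite D0 mulr0 in eD.
have [x10|] := eqVneq x1 0; last exact: sq eD.
have [x30|] := eqVneq x3 0; last exact: sq D0.
case/negP: xn0; apply/eqP; congr Quat => //.
  by move/eqP: eD; rewrite x10 expr0n mulr0 subr0 sqrf_eq0 => /eqP.
by move/eqP: D0; rewrite /D x30 expr0n mulr0 subr0 sqrf_eq0 => /eqP.
Qed.

Lemma is_normN1_sum2 (u v w : K) : (u != 0) || (v != 0) ->
  u ^+ 2 + v ^+ 2 = a * w ^+ 2 -> is_norm a (-1).
Proof.
wlog v0 : u v / v != 0 => [hw uv e|_ e].
  by case/orP: (uv) => h; [apply: (hw v u) | apply: (hw u v)]; rewrite ?h ?orbT // addrC.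
by apply: (@is_norm_ternary _ u w v v0); rewrite -e; ring.
Qed.

(** Multiplying by [Y^2 + Y^2] and composing the two sums of two squares turns the right side into
    [a] times a square. *)
Lemma is_normN1 (X W Y : K) : (2 : K) != 0 -> a != 0 -> Y != 0 ->
  X ^+ 2 + W ^+ 2 = a * (Y ^+ 2 + Y ^+ 2) -> is_norm a (-1).
Proof.
move=> n2 a0 Y0 e.
pose U := X * Y + W * Y; pose V := X * Y - W * Y.
have eUV : U ^+ 2 + V ^+ 2 = a * (Y ^+ 2 + Y ^+ 2) ^+ 2.
  by transitivity ((X ^+ 2 + W ^+ 2) * (Y ^+ 2 + Y ^+ 2)); [rewrite /U /V; ring | rewrite e; ring].
have [/norP[]|] := boolP (~~ ((U != 0) || (V != 0))); last first.
  by rewrite negbK => UV; apply: is_normN1_sum2 UV eUV.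
rewrite !negbK => /eqP U0 /eqP V0.
move/eqP: eUV; rewrite U0 V0 expr0n addr0 eq_sym mulf_eq0 (negbTE a0) /=.
by rewrite sqrf_eq0 -mulr2n -mulr_natr mulf_eq0 (negbTE n2) orbF sqrf_eq0 (negbTE Y0).
Qed.
End Norms.

Section NormPairs.
Variables (K : fieldType) (a : K).

(** Multiplication in [K[T] / (T^2 - a)], with [(x, y)] for [x + y T]: no root of [a] is adjoined,
    and the case of a square [a] needs no separate treatment. *)
Definition pair_mul (u v : K * K) : K * K :=
  (u.1 * v.1 + a * u.2 * v.2, u.1 * v.2 + u.2 * v.1).
Lemma pair_mulA : associative pair_mul.
Proof. by move=> [? ?] [? ?] [? ?]; congr pair => /=; ring. Qed.
Lemma pair_mulC : commutative pair_mul.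
Proof. by move=> [? ?] [? ?]; congr pair => /=; ring. Qed.
Lemma pair_mul1 : left_id (1, 0) pair_mul.
Proof. by move=> [? ?]; congr pair => /=; ring. Qed.
HB.instance Definition _ :=
  Monoid.isComLaw.Build (K * K)%type (1, 0) pair_mul pair_mulA pair_mulC pair_mul1.

Definition pair_norm (u : K * K) : K := u.1 ^+ 2 - a * u.2 ^+ 2.
Lemma pair_normM : {morph pair_norm : u v / pair_mul u v >-> u * v}.
Proof. by move=> [? ?] [? ?]; rewrite /pair_norm /=; ring. Qed.
End NormPairs.

(* The norm of [L / F], applied to [x + y * sqrt a], turns a solution in [L] into
   one in [F] for an odd power of [b]. *)
Lemma is_norm_odd_galois (F : fieldType) (L : splittingFieldType F) (a b : F) :
  galois 1 {:L} -> odd #|'Gal({:L} / 1)%g| -> b != 0 ->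
  is_norm (a%:A : L) b%:A -> is_norm a b.
Proof.
move=> gal oG b0 [x [y exy]].
set G := 'Gal({:L} / 1)%g in oG *.
pose act (g : gal_of {:L}) (u : L * L) := (g u.1, g u.2).
pose w : L * L := \big[pair_mul a%:A/(1, 0)]_(g in G) act g (x, y).
have galA g (k : F) : g \in G -> g k%:A = k%:A :> L.
  by move=> Gg; apply: (fixed_gal (sub1v _) Gg); rewrite memvZ ?mem1v.
have actM g : g \in G -> {morph act g : u v / pair_mul a%:A u v}.
  by move=> Gg [? ?] [? ?]; rewrite /act /pair_mul /= !rmorphD !rmorphM /= galA.
have fix_w g : g \in G -> act g w = w.
  move=> Gg; rewrite /w (big_morph _ (actM g Gg) (id1 := (1, 0))); last first.
    by rewrite /act /= rmorph1 rmorph0.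
  rewrite [RHS](reindex_inj (mulIg g)) /=; apply: eq_big => h.
    by rewrite groupMr.
  by move=> Gh; rewrite /act /= !galM ?memvf.
have inF z : (forall g, g \in G -> g z = z) -> exists k : F, z = k%:A.
  move=> fz; have : z \in fixedField G by apply/fixedFieldP; rewrite ?memvf.
  by move/galois_fixedField: gal => ->; case/vlineP => k ->; exists k.
have [k ek] : exists k : F, w.1 = k%:A by apply: inF => g Gg; rewrite -[in RHS](fix_w g Gg).
have [m em] : exists m : F, w.2 = m%:A by apply: inF => g Gg; rewrite -[in RHS](fix_w g Gg).
have : pair_norm a%:A w = b%:A ^+ #|G|.
  rewrite /w (big_morph _ (pair_normM _) (id1 := 1)); last first.
    by rewrite /pair_norm /=; ring.
  rewrite -prodr_const; apply: eq_bigr => g Gg.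
  by rewrite -(galA g b Gg) exy /pair_norm /= !expr2 rmorphB !rmorphM /= galA.
have algM (u v : F) : (u * v)%:A = u%:A * v%:A :> L by exact: (rmorphM (in_alg L)).
have algX (u : F) n : (u ^+ n)%:A = u%:A ^+ n :> L by exact: (rmorphXn (in_alg L)).
rewrite /pair_norm ek em -!algX -algM -scalerBl => /(fmorph_inj (in_alg L)) e.
(* As the order of [G] is odd, the power of [b] that is a norm from F(sqrt a) is [b] times a nonzero
   square. *)
have eG : #|G| = (#|G|./2).*2.+1 by rewrite -[LHS]odd_double_half oG.
apply: (@is_norm_ternary _ a b k m (b ^+ #|G|./2)); first by rewrite expf_neq0.
have -> : b * (b ^+ #|G|./2) ^+ 2 = b ^+ #|G| by rewrite -exprM muln2 -exprS -eG.
by rewrite -e; ring.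
Qed.

Lemma legendre_eq1 (m : int) (l : nat) : (0 < l)%N ->
  legendre m l = 1 <-> ~~ (l %| m)%Z /\ square_mod l m.
Proof.
move=> l0; rewrite /legendre; case: ifP => lm; first by split=> // -[].
case: ifP => [/fintype.existsP[x /eqP e]|ne]; split=> //.
  by move=> _; split=> //; exists x%:Z; rewrite -eqz_mod_dvd eq_sym; apply/eqP.
move=> [_ [x hx]]; case/negP: (negbT ne); apply/fintype.existsP.
have lz : l%:Z != 0 by clear -l0; lia.
have lt : (`|(x %% l%:Z)%Z| < l)%N by apply: absz_modz_lt.
exists (Ordinal lt); rewrite /= gez0_abs ?modz_ge0 // eq_sym.
by rewrite -[X in X == _]modzXm modz_mod modzXm eqz_mod_dvd.
Qed.

Lemma square_mod_disc (p : nat) (d : int) : prime p -> odd p ->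
  square_mod p (quadratic_disc d) -> square_mod p d.
Proof.
move=> pp op; rewrite /quadratic_disc; case: ifP => // _ [x /dvdzP[k hk]].
have p2 : ~~ (p %| 2)%Z.
  by rewrite dvdzE /= dvdn_prime2 //; apply: contraTneq op => ->.
have [u [v uv]] := prime_inv_mod pp p2.
exists (x * v); apply/dvdzP; exists (k * v ^+ 2 - d * u * (1 + v * 2)).
transitivity ((x ^+ 2 - 4 * d) * v ^+ 2 + d * (v * 2 - 1) * (v * 2 + 1)); first by ring.
have -> : v * 2 - 1 = - (u * p%:Z) by clear -uv; lia.
by rewrite hk; ring.
Qed.

Lemma prime_sqr_eq0 (p : nat) (x y : int) : prime p -> x ^+ 2 = p%:Z * y ^+ 2 -> x = 0 /\ y = 0.
Proof.
move=> pp e; have [y0|y0] := eqVneq y 0.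
  by move/eqP: e; rewrite y0 expr0n mulr0 sqrf_eq0 => /eqP.
have yr : (y%:~R : rat) != 0 by rewrite intr_eq0.
have sq1 : squarefree 1.
  by move=> m; rewrite dvdzE /= dvdn1 abszX; case: m => [[|[|n]]|[|n]] //; rewrite expnS; lia.
have [n en] : exists n : int, (x%:~R / y%:~R : rat) = n%:~R.
  apply: (@rat_sqrt_int 1 p) sq1 _.
  rewrite mul1r expr_div_n; apply: (mulIf (expf_neq0 2 yr)); rewrite divfK ?expf_neq0 //.
  by rewrite -!rmorphXn -intrM /= e.
have /eqP[] := prime_nonsquare pp n.
have : x%:~R = (n * y)%:~R :> rat by rewrite intrM -en divfK.
move/intr_inj => ex; have y2 : y ^+ 2 != 0 by rewrite sqrf_eq0.
by apply: (mulIf y2); rewrite -e ex exprMn.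
Qed.

(** * Norms from F(sqrt p) *)

Section QuadraticNorms.
Variables (F : fieldExtType rat) (d : int) (s : F).
Hypotheses (d_neg : d < 0) (s_sqr : s ^+ 2 = d%:~R) (s_gen : <<1; s>>%VS = fullv).

Lemma two_neq0 : (2 : F) != 0.
Proof. by rewrite -(rmorph_nat (in_alg F) 2) fmorph_eq0. Qed.

Lemma natF_neq0 (p : nat) : prime p -> (p%:R : F) != 0.
Proof.
by move=> pp; rewrite -(rmorph_nat (in_alg F)) fmorph_eq0 pnatr_eq0 -lt0n prime_gt0.
Qed.

Lemma intF_eq0 (m : int) : (m%:~R == 0 :> F) = (m == 0).
Proof. by rewrite -[0]/(0%:~R) (inj_eq (@fieldExt_intr_inj F)). Qed.

Lemma common_denominator (x : F) : exists (D a b : int),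
  0 < D /\ x * D%:~R = a%:~R + b%:~R * s.
Proof.
have [u [v ->]] := quad_coords s_sqr s_gen x.
have [n [D [D0 _ e _]]] := rat_reduced u; have [n' [D' [D'0 _ e' _]]] := rat_reduced v.
exists (D * D'), (n * D'), (n' * D); split; first exact: mulr_gt0.
have algM (f g : rat) : (f * g)%:A = f%:A * g%:A :> F by exact: (rmorphM (in_alg F)).
rewrite !intrM -(alg_int F n) -(alg_int F n') -e -e' !algM !alg_int -(mulr_algl v s).
by move: (u%:A : F) (v%:A : F) => U V; ring.
Qed.

(* At a prime [l] that splits in [F], [F] embeds in the field of [l]-adic numbers. *)
Lemma anisotropic_not_norm (p q : nat) (l : int) : 1 < l ->
  (forall k, square_mod (l ^+ k) d) -> anisotropic_at l p q ->
  ~ is_norm (p%:R : F) q%:R.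
Proof.
move=> l1 sq an [x [y e]].
have [D [a [b [D0 ex]]]] := common_denominator x.
have [D' [a' [b' [D'0 ey]]]] := common_denominator y.
pose E := D * D'.
have E0 : 0 < E by apply: mulr_gt0.
have eE : ((a * D')%:~R + (b * D')%:~R * s) ^+ 2 =
    p%:~R * ((a' * D)%:~R + (b' * D)%:~R * s) ^+ 2 + (q%:Z * E ^+ 2)%:~R.
  have -> : (a * D')%:~R + (b * D')%:~R * s = x * D%:~R * D'%:~R by rewrite !intrM ex; ring.
  have -> : (a' * D)%:~R + (b' * D)%:~R * s = y * D'%:~R * D%:~R by rewrite !intrM ey; ring.
  have -> : (q%:Z * E ^+ 2)%:~R = q%:R * (D%:~R * D'%:~R) ^+ 2 :> F.
    by rewrite /E !expr2 !intrM -pmulrn; ring.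
  by rewrite -pmulrn e; ring.
move: (a * D') (b * D') (a' * D) (b' * D) eE => x0 x1 y0 y1 eE.
suff [h1 h2] : x0 ^+ 2 + d * x1 ^+ 2 = p%:Z * (y0 ^+ 2 + d * y1 ^+ 2) + q%:Z * E ^+ 2 /\
    2 * (x0 * x1) = 2 * (p%:Z * (y0 * y1)).
  (* After clearing denominators the third variable is the common denominator [E], with zero
     coordinate along [s]; the local obstruction forces it to vanish. *)
  have E00 : E = 0.
    apply: (@anisotropic_quadratic d l p q d_neg l1 sq an x0 x1 y0 y1 E 0).
      by rewrite h1; ring.
    by apply: (@mulfI _ (2 : int)) => //; rewrite h2; ring.
  by rewrite E00 in E0.
have : ((x0 ^+ 2 + d * x1 ^+ 2)%:~R : rat)%:A + ((2 * (x0 * x1))%:~R : rat) *: s =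
    ((p%:Z * (y0 ^+ 2 + d * y1 ^+ 2) + q%:Z * E ^+ 2)%:~R : rat)%:A +
    ((2 * (p%:Z * (y0 * y1)))%:~R : rat) *: s.
  rewrite -!(mulr_algl _ s) !alg_int.
  transitivity ((x0%:~R + x1%:~R * s) ^+ 2); first by rewrite !expr2 !(intrD, intrM) -s_sqr; ring.
  by rewrite eE !expr2 !(intrD, intrM) -s_sqr; ring.
by case/(quad_coords_inj d_neg s_sqr) => /intr_inj -> /intr_inj ->.
Qed.

Lemma is_normN_int (p q : nat) : prime p -> prime q -> p != q ->
  p = 3 %[mod 4] -> q = 3 %[mod 4] -> ~ square_mod p q -> is_norm (p%:R : F) (- q%:R).
Proof.
move=> pp qp npq p4 q4 npsq.
have [x [y [z [nz e]]]] := norm_solution pp qp npq p4 q4 npsq.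
have z0 : z != 0.
  apply: contraNneq nz => z0; rewrite z0 expr0n mulr0 addr0 in e.
  by have [-> ->] := prime_sqr_eq0 pp e; rewrite z0.
apply: (@is_norm_ternary _ _ _ x%:~R y%:~R z%:~R); first by rewrite intF_eq0.
move/(congr1 (intr : int -> F)): e; rewrite !expr2 !(intrD, intrM) mulrNz.
by rewrite -!pmulrn.
Qed.

(** Apart from [d = -1], where [-1 = s^2], it suffices to write [p] or [2 p] times a nonzero square
    as a sum of two squares in [F]. The second square is taken of the form [d W^2 = (s W)^2], which
    leaves a ternary equation over the integers. *)
Lemma is_normN1_imaginary (p : nat) : prime p -> p = 3 %[mod 4] ->
  [\/ d = -1, d = -2 | exists r : nat, [/\ prime r, r = 3 %[mod 4] & d = - r%:Z]] ->
  legendre (quadratic_disc d) p <> 1 -> ~ (d = 1 %[mod 8])%Z ->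
  is_norm (p%:R : F) (-1).
Proof.
move=> pp p4 cases leg d8.
have n2 := two_neq0; have pF := natF_neq0 pp.
have p0 := prime_gt0 pp.
have conclude (X W Y : int) : Y != 0 -> X ^+ 2 + d * W ^+ 2 = p%:Z * (Y ^+ 2 + Y ^+ 2) ->
    is_norm (p%:R : F) (-1).
  move=> Y0 e; apply: (@is_normN1 _ _ X%:~R (s * W%:~R) Y%:~R) => //; first by rewrite intF_eq0.
  move/(congr1 (intr : int -> F)): e; rewrite exprMn s_sqr !expr2 !(intrD, intrM).
  by rewrite -pmulrn.
case: cases => [d1|d2|[r [rp r4 dr]]].
- by exists s, 0; rewrite s_sqr d1 mulrNz expr0n mulr0 subr0.
(* For [p = 3] modulo 8, 2 is a nonresidue, so -2 and with it the discriminant -8 is a residue. *)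
- have p8 : p = 7 %[mod 8].
    have [p3|//] : p = 3 %[mod 8] \/ p = 7 %[mod 8] by clear -p4; lia.
    case: leg; apply/legendre_eq1 => //; rewrite d2; split.
      rewrite -[quadratic_disc _]/(- (2 * 2 * 2)%N%:Z) dvdzE abszN /= !Euclid_dvdM //.
      by rewrite !orbb dvdn_prime2 //; apply: contra_eqN p4 => /eqP ->.
    case: (square_mod_or_opp pp p4 (-2)) => [[x hx]|h]; last first.
      by case: (@nonsquare_mod8 p 2 pp) => //; left.
    exists (2 * x); rewrite (_ : _ - _ = 4 * (x ^+ 2 - - 2)) ?dvdz_mull //.
    by rewrite -[quadratic_disc _]/(-8); ring.
  have [x [y [z [nz e]]]] := solution_mod8_7 pp p8.
  apply: (@is_normN1_sum2 _ _ x%:~R (s * z%:~R) y%:~R).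
    rewrite mulf_eq0 !intF_eq0 -sqrf_eq0 s_sqr d2 intF_eq0 /=.
    rewrite -negb_and; apply: contraNN nz => /andP[/eqP x0 /eqP z0].
    move/eqP: e; rewrite x0 z0 !expr0n mulr0 addr0 eq_sym mulf_eq0 sqrf_eq0.
    by rewrite eqz_nat (gtn_eqF p0) /= => /eqP ->.
  move/(congr1 (intr : int -> F)): e; rewrite exprMn s_sqr d2 mulrNz !expr2 !(intrD, intrM).
  by rewrite -pmulrn => ->; ring.
have disc : quadratic_disc d = d.
  by rewrite /quadratic_disc (_ : (d == 1 %[mod 4])%Z) // dr; apply/eqP; clear -r4; lia.
have r8 : r = 3 %[mod 8] by rewrite dr in d8; clear -r4 d8; lia.
have [epr|npr] := eqVneq p r.
  rewrite -epr in r8 dr.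
  have [x [y [z [nz e]]]] := solution_mod8_3 pp r8.
  (* With [d = - p], multiplying [x^2 = p y^2 - 2 z^2] by [p] gives [(p y)^2 - p x^2 = 2 p z^2]. *)
  apply: (conclude (p%:Z * y) x z).
    apply: contraNneq nz => z0; rewrite z0 expr0n mulr0 addr0 in e.
    by have [-> ->] := prime_sqr_eq0 pp e; rewrite z0.
  by rewrite dr e; ring.
have psq : square_mod p r.
  case: (square_mod_or_opp pp p4 r) => // sq.
  case: leg; apply/legendre_eq1 => //; rewrite disc dr; split=> //.
  by rewrite dvdzE abszN /= dvdn_prime2.
have [x [y [z [nz e]]]] := solution_two_primes pp rp npr p4 r8 psq.
apply: (conclude x z y); last by rewrite e dr; ring.
apply: contraNneq nz => y0; rewrite y0 expr0n mulr0 add0r in e.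
by have [-> ->] := prime_sqr_eq0 rp e; rewrite y0.
Qed.
End QuadraticNorms.

Theorem proposition6p8
    (l : nat) (l_prime : prime l) (l_odd : odd l)
    (d : int) (d_squarefree : squarefree d) (d_neq1 : d != 1)
    (F : fieldExtType rat) (F_quadratic : generated_by_sqrt F d)
    (F_imaginary : d < 0)
    (F_class_number : has_class_number F l)
    (L : splittingFieldType F) (L_hilbert : is_hilbert_class_field L)
    (p q : nat) (p_prime : prime p) (q_prime : prime q)
    (p_odd : odd p) (q_odd : odd q) (p_neq_q : p != q)
    (q_p : legendre q%:Z p <> 1)
    (p_mod4 : p = 3 %[mod 4]) (q_mod4 : q = 3 %[mod 4]) :
  division_algebra (quaternion (p%:R : L) (q%:R : L)) <->
  (legendre (quadratic_disc d) p = 1 \/ (d = 1 %[mod 8])%Z).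
Proof.
case: F_quadratic => s [s_sqr s_gen].
have [c c_s] := quadratic_conj F_imaginary s_sqr s_gen.
have p0 := prime_gt0 p_prime.
have npsq : ~ square_mod p q.
  by move=> sq; apply: q_p; apply/legendre_eq1 => //; rewrite dvdzE /= dvdn_prime2.
have natL (n : nat) : n%:R = (n%:R : F)%:A :> L by exact: (esym (rmorph_nat (in_alg L) n)).
have pL : (p%:R : L) != 0 by rewrite natL -[_%:A]/(in_alg L _) fmorph_eq0 natF_neq0.
have n2L : (2 : L) != 0 by rewrite (natL 2) -[_%:A]/(in_alg L _) fmorph_eq0 two_neq0.
have algM (u v : F) : (u * v)%:A = u%:A * v%:A :> L by exact: (rmorphM (in_alg L)).
have cases := odd_class_number_cases F_imaginary d_squarefree s_sqr s_gen c_s l_odd F_class_number.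
apply: iff_trans (norm_quaternion_division q%:R n2L pL) _; split=> [nn|cond].
  have [|leg] := pselect (legendre (quadratic_disc d) p = 1); first by left.
  have [|d8] := pselect (d = 1 %[mod 8])%Z; first by right.
  case: nn.
  (* [q] is the product of [-1] and [-q], both norms already over [F]. *)
  have N1 := is_normN1_imaginary s_sqr p_prime p_mod4 cases leg d8.
  have Nq := is_normN_int F p_prime q_prime p_neq_q p_mod4 q_mod4 npsq.
  have [x [y e]] := is_normM N1 Nq; exists x%:A, y%:A.
  rewrite !natL !expr2 -!algM -scalerBl -!expr2 -e.
  by rewrite mulrNN mul1r.
have odd_L : odd #|'Gal({:L} / 1)%g|.
  apply: (hilbert_class_field_odd F_imaginary d_squarefree s_sqr s_gen c_s) => //.
  case: cases => [d1|->|]; [| by left | by right].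
  (* For [d = -1] the first alternative would make 4 and -4 both squares modulo [p], and -1 is not 1
     modulo 8. *)
  exfalso; case: cond => [|]; last by rewrite d1.
  rewrite d1 => /(legendre_eq1 _ p0)[_ sq].
  have sq4 : square_mod p 4 by exists 2; rewrite subrr dvdz0.
  have := square_mod_opp_dvd p_prime p_mod4 sq4 sq.
  rewrite dvdzE => p4; have p3 : p = 3%N.
    by have := dvdn_leq (isT : (0 < 4)%N) p4; clear -p_mod4; lia.
  by rewrite p3 in p4.
rewrite !natL => /(is_norm_odd_galois (galois_rat_ext L) odd_L (natF_neq0 _ q_prime)).
case: cond => [/(legendre_eq1 _ p0)[pd sq]|d8].
  apply: (@anisotropic_not_norm F d s F_imaginary s_sqr s_gen p q p).
  - by have := prime_gt1 p_prime; clear; lia.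
  - apply: square_mod_exp_odd => //.
      apply: contraNN pd => pd; rewrite /quadratic_disc; case: ifP => // _.
      by rewrite dvdz_mull.
    exact: square_mod_disc.
  - exact: anisotropic_at_prime.
apply: (@anisotropic_not_norm F d s F_imaginary s_sqr s_gen p q 2) => //.
- exact: square_mod_exp_2.
- by apply: anisotropic_at_2; clear -p_mod4 q_mod4; lia.
Qed.
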